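(* Let $\mathcal I$ be a tensor ideal of $\mathcal T$ satisfying the standing assumption in the context. Then in $\mathcal T/\mathcal I$ the following relations hold: $$m\circ\mathsf H=-\frac{[9]}{[3]}\,m,$$ $$\mathsf S=\frac{q^{10}+q^8+q^6+q^4+1}{q^4(q^4+1)^2}\,1_2+\frac{q^2(q^{10}+q^6+q^4+q^2+1)}{(q^4+1)^2}\,\mathsf U-\frac{[2][3][6]}{[4]^2}\,\sigma_++\frac{q^{10}+2q^6+q^2+1}{q^8+q^4}\,\mathsf H+\frac{q^{10}+q^8+2q^4+1}{q^6+q^2}\,\mathsf N.$$
   Context: $[n]=\frac{q^n-q^{-n}}{q-q^{-1}}$. **Monoidal notation.** $\mathbb 1$ is the unit object, morphisms compose right to left ($fg=f\circ g$), $1$ denotes the identity of the object $\mathsf I$, and $1_n$ the identity of $\mathsf I^{\otimes n}$. (String diagrams are read bottom to top; $m$ is a trivalent merge; $\sigma_+$ is the crossing in which the strand from bottom left to top right passes over, $\sigma_-$ the opposite crossing.) **The category $\mathcal T$.** Let $\Bbbk=\mathbb Q(q)$, $\tau=q^{12}$, $\beta=q^{24}$, $\delta=\frac{[3][8][13][18]}{[4][6][9]}$, $\phi=\frac{[2][7][12]}{[4][6]}$. $\mathcal T$ is the strict $\Bbbk$-linear monoidal category generated by one object $\mathsf I$ and morphisms $m:\mathsf I^{\otimes2}\to\mathsf I$, $\sigma_+,\sigma_-:\mathsf I^{\otimes 2}\to\mathsf I^{\otimes2}$, $\cup:\mathbb1\to\mathsf I^{\otimes2}$, $\cap:\mathsf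 I^{\otimes2}\to\mathbb1$, subject to: (R1) $(\cap\otimes1)(1\otimes\cup)=1=(1\otimes\cap)(\cup\otimes1)$; (R2) $(1\otimes m)(\cup\otimes1)=(m\otimes1)(1\otimes\cup)$; this common morphism $\mathsf I\to\mathsf I^{\otimes2}$ is denoted $s$; (R3) $(1\otimes\cap)(\sigma_-\otimes1)=(\cap\otimes1)(1\otimes\sigma_+)$ and $(1\otimes\cap)(\sigma_+\otimes1)=(\cap\otimes1)(1\otimes\sigma_-)$; (R4) $\sigma_-\sigma_+=1_2=\sigma_+\sigma_-$; (R5) $(\sigma_+\otimes1)(1\otimes\sigma_+)(\sigma_+\otimes1)=(1\otimes\sigma_+)(\sigma_+\otimes1)(1\otimes\sigma_+)$; (R6) $(1\otimes m)(\sigma_+\otimes1)(1\otimes\sigma_+)=\sigma_+(m\otimes1)$; (R7) $(1\otimes\sigma_+)(\sigma_+\otimes1)(1\otimes s)=(s\otimes1)\sigma_+$; (R8) $\cap\sigma_+=\beta\cap$, $m\sigma_+=\tau m$, $ms=\phi 1$, $\cap\cup=\delta1_{\mathbb1}$, $m\cup=0$. Put $\mathsf U=\cup\cap$, $\mathsf H=(m\otimes1)(1\otimes s)=(1\otimes m)(s\otimes1)$, $\mathsf N=sm$, and $\mathsf S=\mathsf H\circ\mathsf H$ (the square diagram); $m\circ\mathsf H$ is the triangle diagram. **Standing assumption.** $\delta\notin\{q^4+q^{-4},\,-q^{16}-q^{-16}\}$, and $\mathcal I$ is a tensor ideal of $\mathcal T$ such that $1_2,\ \mathsf U,\ \mathsf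 H,\ \mathsf N,\ \sigma_++\sigma_-$ form a $\Bbbk$-basis of $(\mathcal T/\mathcal I)(\mathsf I^{\otimes2},\mathsf I^{\otimes2})$. The same symbols denote morphisms of $\mathcal T$ and their images in $\mathcal T/\mathcal I$. *)

(* Defs.v *)
From HB Require Import structures.
From mathcomp Require Import all_boot all_order all_algebra.
From mathcomp Require Import generic_quotient boolp.

Set Implicit Arguments.
Unset Strict Implicit.
Unset Printing Implicit Defensive.

Import GRing.Theory.
Local Open Scope quotient_scope.
Local Open Scope ring_scope.

Notation Qq := {fraction {poly rat}}.

Definition q : Qq := tofrac ('X : {poly rat}).
Definition qint (n : nat) : Qq := (q ^+ n - q ^- n) / (q - q^-1).

Definition tau : Qq := q ^+ 12.
Definition beta : Qq := q ^+ 24.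
Definition delta : Qq :=
  (qint 3 * qint 8 * qint 13 * qint 18) / (qint 4 * qint 6 * qint 9).
Definition phi : Qq := (qint 2 * qint 7 * qint 12) / (qint 4 * qint 6).

(* In a strict monoidal category on one generating object I, the n-th tensor
   power of I is represented by n : nat, so that the unit object is 0 and the
   tensor product of objects is addition. *)

(* Strict associativity and unitality of the tensor product of morphisms need
   transport along equalities between objects. *)
Definition cast (X : nat -> nat -> Type) a b a' b'
    (ea : a = a') (eb : b = b') (f : X a b) : X a' b' :=
  let: erefl := ea in let: erefl := eb in f.

(* The operations without the laws. Composition is written in the order of
   functions: mcomp g f is "g after f". *)
Record raw_moncat := RawMoncat {
  raw_hom :> nat -> nat -> Type;
  raw_zero : forall a b, raw_hom a b;
  raw_add : forall a b, raw_hom a b -> raw_hom a b -> raw_hom a b;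
  raw_scale : forall a b, Qq -> raw_hom a b -> raw_hom a b;
  raw_id : forall a, raw_hom a a;
  raw_comp : forall a b c, raw_hom b c -> raw_hom a b -> raw_hom a c;
  raw_tens : forall a b c d,
    raw_hom a b -> raw_hom c d -> raw_hom (a + c)%N (b + d)%N }.

Arguments raw_zero {_ _ _}.
Arguments raw_id {_}.

Definition hom_rel (X : nat -> nat -> Type) := forall a b, X a b -> X a b -> Prop.

(* E is a congruence modulo which the laws of a strict Q(q)-linear monoidal
   category hold. *)
Record moncat_congr (P : raw_moncat)
    (E : forall {a b}, P a b -> P a b -> Prop) : Prop := MoncatCongr {
  mc_refl : forall a b (f : P a b), E f f;
  mc_sym : forall a b (f g : P a b), E f g -> E g f;
  mc_trans : forall a b (f g h : P a b), E f g -> E g h -> E f h;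
  mc_add : forall a b (f f' g g' : P a b),
    E f f' -> E g g' -> E (raw_add f g) (raw_add f' g');
  mc_scale : forall a b k (f f' : P a b),
    E f f' -> E (raw_scale k f) (raw_scale k f');
  mc_comp : forall a b c (g g' : P b c) (f f' : P a b),
    E g g' -> E f f' -> E (raw_comp g f) (raw_comp g' f');
  mc_tens : forall a b c d (f f' : P a b) (g g' : P c d),
    E f f' -> E g g' -> E (raw_tens f g) (raw_tens f' g');
  mc_addA : forall a b (f g h : P a b),
    E (raw_add f (raw_add g h)) (raw_add (raw_add f g) h);
  mc_addC : forall a b (f g : P a b), E (raw_add f g) (raw_add g f);
  mc_add0 : forall a b (f : P a b), E (raw_add raw_zero f) f;
  mc_addN : forall a b (f : P a b), E (raw_add (raw_scale (-1) f) f) raw_zero;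
  mc_scaleA : forall a b k l (f : P a b),
    E (raw_scale k (raw_scale l f)) (raw_scale (k * l) f);
  mc_scale1 : forall a b (f : P a b), E (raw_scale 1 f) f;
  mc_scaleDr : forall a b k (f g : P a b),
    E (raw_scale k (raw_add f g)) (raw_add (raw_scale k f) (raw_scale k g));
  mc_scaleDl : forall a b k l (f : P a b),
    E (raw_scale (k + l) f) (raw_add (raw_scale k f) (raw_scale l f));
  mc_compA : forall a b c d (h : P c d) (g : P b c) (f : P a b),
    E (raw_comp h (raw_comp g f)) (raw_comp (raw_comp h g) f);
  mc_comp1l : forall a b (f : P a b), E (raw_comp (raw_id b) f) f;
  mc_comp1r : forall a b (f : P a b), E (raw_comp f (raw_id a)) f;
  mc_compDl : forall a b c (g g' : P b c) (f : P a b),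
    E (raw_comp (raw_add g g') f) (raw_add (raw_comp g f) (raw_comp g' f));
  mc_compDr : forall a b c (g : P b c) (f f' : P a b),
    E (raw_comp g (raw_add f f')) (raw_add (raw_comp g f) (raw_comp g f'));
  mc_compZl : forall a b c k (g : P b c) (f : P a b),
    E (raw_comp (raw_scale k g) f) (raw_scale k (raw_comp g f));
  mc_compZr : forall a b c k (g : P b c) (f : P a b),
    E (raw_comp g (raw_scale k f)) (raw_scale k (raw_comp g f));
  mc_tens1 : forall a b,
    E (raw_tens (raw_id a) (raw_id b)) (raw_id (a + b)%N);
  mc_tens_comp : forall a b c a' b' c'
      (g : P b c) (f : P a b) (g' : P b' c') (f' : P a' b'),
    E (raw_tens (raw_comp g f) (raw_comp g' f'))
      (raw_comp (raw_tens g g') (raw_tens f f'));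
  mc_tensA : forall a b c d e x (f : P a b) (g : P c d) (h : P e x),
    E (cast (addnA a c e) (addnA b d x) (raw_tens f (raw_tens g h)))
      (raw_tens (raw_tens f g) h);
  mc_tens1l : forall a b (f : P a b), E (raw_tens (raw_id 0) f) f;
  mc_tens1r : forall a b (f : P a b),
    E (cast (addn0 a) (addn0 b) (raw_tens f (raw_id 0))) f;
  mc_tensDl : forall a b c d (f f' : P a b) (g : P c d),
    E (raw_tens (raw_add f f') g) (raw_add (raw_tens f g) (raw_tens f' g));
  mc_tensDr : forall a b c d (f : P a b) (g g' : P c d),
    E (raw_tens f (raw_add g g')) (raw_add (raw_tens f g) (raw_tens f g'));
  mc_tensZl : forall a b c d k (f : P a b) (g : P c d),
    E (raw_tens (raw_scale k f) g) (raw_scale k (raw_tens f g));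
  mc_tensZr : forall a b c d k (f : P a b) (g : P c d),
    E (raw_tens f (raw_scale k g)) (raw_scale k (raw_tens f g)) }.

Definition raw_of (hom : nat -> nat -> lmodType Qq)
    (mid : forall a, hom a a)
    (mcomp : forall a b c, hom b c -> hom a b -> hom a c)
    (mtens : forall a b c d, hom a b -> hom c d -> hom (a + c)%N (b + d)%N) :=
  @RawMoncat hom (fun _ _ => 0) (fun _ _ => +%R) (fun _ _ => *:%R)
    mid mcomp mtens.

Record moncat := Moncat {
  mor :> nat -> nat -> lmodType Qq;
  mid : forall a, mor a a;
  mcomp : forall a b c, mor b c -> mor a b -> mor a c;
  mtens : forall a b c d, mor a b -> mor c d -> mor (a + c)%N (b + d)%N;
  moncatP : @moncat_congr (raw_of mid mcomp mtens) (fun a b => @eq (mor a b)) }.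

Arguments mid {_}.

Declare Scope moncat_scope.
Delimit Scope moncat_scope with C.
Local Open Scope moncat_scope.

Notation "g ∘ f" := (mcomp g f) (at level 40, left associativity) : moncat_scope.
Notation "f ⊗ g" := (mtens f g) (at level 38, left associativity) : moncat_scope.

Definition raw (C : moncat) : raw_moncat := raw_of (@mid C) (@mcomp C) (@mtens C).

Section BilinearTheory.
Variable C : moncat.

Lemma compBr a b c (g : C b c) (f f' : C a b) :
  g ∘ (f - f') = g ∘ f - g ∘ f'.
Proof.
have compD h : g ∘ (f + h) = g ∘ f + g ∘ h by exact: (mc_compDr (moncatP C)).
have compZ k h : g ∘ (k *: h) = k *: (g ∘ h) by exact: (mc_compZr (moncatP C)).
by rewrite compD -scaleN1r compZ scaleN1r.
Qed.

Lemma compBl a b c (g g' : C b c) (f : C a b) :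
  (g - g') ∘ f = g ∘ f - g' ∘ f.
Proof.
have compD h : (g + h) ∘ f = g ∘ f + h ∘ f by exact: (mc_compDl (moncatP C)).
have compZ k h : (k *: h) ∘ f = k *: (h ∘ f) by exact: (mc_compZl (moncatP C)).
by rewrite compD -scaleN1r compZ scaleN1r.
Qed.

Lemma tensBr a b c d (f : C a b) (g g' : C c d) :
  f ⊗ (g - g') = f ⊗ g - f ⊗ g'.
Proof.
have tensD h : f ⊗ (g + h) = f ⊗ g + f ⊗ h by exact: (mc_tensDr (moncatP C)).
have tensZ k h : f ⊗ (k *: h) = k *: (f ⊗ h) by exact: (mc_tensZr (moncatP C)).
by rewrite tensD -scaleN1r tensZ scaleN1r.
Qed.

Lemma tensBl a b c d (f f' : C a b) (g : C c d) :
  (f - f') ⊗ g = f ⊗ g - f' ⊗ g.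
Proof.
have tensD h : (f + h) ⊗ g = f ⊗ g + h ⊗ g by exact: (mc_tensDl (moncatP C)).
have tensZ k h : (k *: h) ⊗ g = k *: (h ⊗ g) by exact: (mc_tensZl (moncatP C)).
by rewrite tensD -scaleN1r tensZ scaleN1r.
Qed.

End BilinearTheory.

Section Quotient.
Variables (P : raw_moncat) (E : hom_rel P) (EP : moncat_congr E).

Definition qrel a b : rel {classic P a b} := fun f g => `[< E f g >].

Lemma qrel_equiv a b : equiv_class_of (@qrel a b).
Proof.
split=> [f|f g|g f h].
- by apply/asboolP; apply: (mc_refl EP).
- by apply/asboolP/asboolP; apply: (mc_sym EP).
- by move=> /asboolP fg /asboolP gh; apply/asboolP; apply: (mc_trans EP) fg gh.
Qed.

Canonical qequiv a b := EquivRelPack (@qrel_equiv a b).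

Definition qhom a b := {eq_quot (qequiv a b)}.

HB.instance Definition _ a b := Choice.on (qhom a b).

Definition qpi a b (f : P a b) : qhom a b := \pi_(qhom a b) (f : {classic P a b}).
Definition qrepr a b (x : qhom a b) : P a b := repr x.

Lemma qreprK a b (x : qhom a b) : qpi (qrepr x) = x.
Proof. exact: reprK. Qed.

Lemma qpiP a b (f g : P a b) : qpi f = qpi g <-> E f g.
Proof.
split=> [fg|fg].
  by apply/asboolP; apply/(@eqquotP _ (qequiv a b) (qhom a b)).
by apply/(@eqquotP _ (qequiv a b) (qhom a b)); apply/asboolP.
Qed.

Lemma qreprP a b (f : P a b) : E (qrepr (qpi f)) f.
Proof. by apply/qpiP; rewrite qreprK. Qed.

Definition qadd a b (x y : qhom a b) := qpi (raw_add (qrepr x) (qrepr y)).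
Definition qscale a b k (x : qhom a b) := qpi (raw_scale k (qrepr x)).
Definition qcomp a b c (y : qhom b c) (x : qhom a b) :=
  qpi (raw_comp (qrepr y) (qrepr x)).
Definition qtens a b c d (x : qhom a b) (y : qhom c d) :=
  qpi (raw_tens (qrepr x) (qrepr y)).

Lemma qpi_add a b (f g : P a b) : qadd (qpi f) (qpi g) = qpi (raw_add f g).
Proof. by apply/qpiP/(mc_add EP); apply: qreprP. Qed.
Lemma qpi_scale a b k (f : P a b) : qscale k (qpi f) = qpi (raw_scale k f).
Proof. by apply/qpiP/(mc_scale EP); apply: qreprP. Qed.
Lemma qpi_comp a b c (g : P b c) (f : P a b) :
  qcomp (qpi g) (qpi f) = qpi (raw_comp g f).
Proof. by apply/qpiP/(mc_comp EP); apply: qreprP. Qed.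
Lemma qpi_tens a b c d (f : P a b) (g : P c d) :
  qtens (qpi f) (qpi g) = qpi (raw_tens f g).
Proof. by apply/qpiP/(mc_tens EP); apply: qreprP. Qed.
Lemma qpi_cast a b a' b' (ea : a = a') (eb : b = b') (f : P a b) :
  cast ea eb (qpi f) = qpi (cast ea eb f).
Proof. by case: a' / ea; case: b' / eb. Qed.

Lemma qind a b (Q : qhom a b -> Prop) : (forall f, Q (qpi f)) -> forall x, Q x.
Proof. by move=> Qpi x; rewrite -[x]qreprK. Qed.

Fact qaddA a b : associative (@qadd a b).
Proof.
elim/qind=> f; elim/qind=> g; elim/qind=> h.
by rewrite !qpi_add; apply/qpiP/(mc_addA EP).
Qed.
Fact qaddC a b : commutative (@qadd a b).
Proof.
by elim/qind=> f; elim/qind=> g; rewrite !qpi_add; apply/qpiP/(mc_addC EP).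
Qed.
Fact qadd0 a b : left_id (qpi raw_zero) (@qadd a b).
Proof. by elim/qind=> f; rewrite qpi_add; apply/qpiP/(mc_add0 EP). Qed.
Fact qaddN a b : left_inverse (qpi raw_zero) (@qscale a b (-1)) (@qadd a b).
Proof.
by elim/qind=> f; rewrite qpi_scale qpi_add; apply/qpiP/(mc_addN EP).
Qed.

HB.instance Definition _ a b := GRing.isZmodule.Build (qhom a b)
  (@qaddA a b) (@qaddC a b) (@qadd0 a b) (@qaddN a b).

Fact qscaleA a b k l (x : qhom a b) : qscale k (qscale l x) = qscale (k * l) x.
Proof.
by elim/qind: x => f; rewrite !qpi_scale; apply/qpiP/(mc_scaleA EP).
Qed.
Fact qscale1 a b : left_id 1 (@qscale a b).
Proof. by elim/qind=> f; rewrite qpi_scale; apply/qpiP/(mc_scale1 EP). Qed.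
Fact qscaleDr a b : right_distributive (@qscale a b) +%R.
Proof.
move=> k; elim/qind=> f; elim/qind=> g.
by rewrite [_ + _]qpi_add !qpi_scale [_ + _]qpi_add; apply/qpiP/(mc_scaleDr EP).
Qed.
Fact qscaleDl a b (x : qhom a b) : {morph (@qscale a b)^~ x : k l / k + l}.
Proof.
elim/qind: x => f k l.
by rewrite !qpi_scale [RHS]qpi_add; apply/qpiP/(mc_scaleDl EP).
Qed.

HB.instance Definition _ a b := GRing.Zmodule_isLmodule.Build Qq (qhom a b)
  (@qscaleA a b) (@qscale1 a b) (@qscaleDr a b) (@qscaleDl a b).

Definition qlmod a b : lmodType Qq := qhom a b.

Fact quotient_congr :
  @moncat_congr (raw_of (hom := qlmod) (fun a => qpi (raw_id a)) qcomp qtens)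
    (fun a b => @eq (qlmod a b)).
Proof.
split=> /=.
- by [].
- by move=> a b f g ->.
- by move=> a b f g h -> ->.
- by move=> a b f f' g g' -> ->.
- by move=> a b k f f' ->.
- by move=> a b c g g' f f' -> ->.
- by move=> a b c d f f' g g' -> ->.
- by move=> *; rewrite addrA.
- by move=> *; rewrite addrC.
- by move=> *; rewrite add0r.
- by move=> *; rewrite scaleN1r addNr.
- by move=> *; rewrite scalerA.
- by move=> *; rewrite scale1r.
- by move=> *; rewrite scalerDr.
- by move=> *; rewrite scalerDl.
- move=> a b c d; elim/qind=> h; elim/qind=> g; elim/qind=> f.
  by rewrite !qpi_comp; apply/qpiP/(mc_compA EP).
- by move=> a b; elim/qind=> f; rewrite qpi_comp; apply/qpiP/(mc_comp1l EP).
- by move=> a b; elim/qind=> f; rewrite qpi_comp; apply/qpiP/(mc_comp1r EP).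
- move=> a b c; elim/qind=> g; elim/qind=> g'; elim/qind=> f.
  rewrite [_ + _]qpi_add !qpi_comp [_ + _]qpi_add.
  by apply/qpiP/(mc_compDl EP).
- move=> a b c; elim/qind=> g; elim/qind=> f; elim/qind=> f'.
  rewrite [_ + _]qpi_add !qpi_comp [_ + _]qpi_add.
  by apply/qpiP/(mc_compDr EP).
- move=> a b c k; elim/qind=> g; elim/qind=> f.
  rewrite [_ *: _]qpi_scale !qpi_comp [_ *: _]qpi_scale.
  by apply/qpiP/(mc_compZl EP).
- move=> a b c k; elim/qind=> g; elim/qind=> f.
  rewrite [_ *: _]qpi_scale !qpi_comp [_ *: _]qpi_scale.
  by apply/qpiP/(mc_compZr EP).
- by move=> a b; rewrite qpi_tens; apply/qpiP/(mc_tens1 EP).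
- move=> a b c a' b' c'; elim/qind=> g; elim/qind=> f; elim/qind=> g'.
  elim/qind=> f'; rewrite !(qpi_comp, qpi_tens).
  by apply/qpiP/(mc_tens_comp EP).
- move=> a b c d e x; elim/qind=> f; elim/qind=> g; elim/qind=> h.
  by rewrite !qpi_tens qpi_cast; apply/qpiP/(mc_tensA EP).
- by move=> a b; elim/qind=> f; rewrite qpi_tens; apply/qpiP/(mc_tens1l EP).
- move=> a b; elim/qind=> f; rewrite qpi_tens qpi_cast.
  by apply/qpiP/(mc_tens1r EP).
- move=> a b c d; elim/qind=> f; elim/qind=> f'; elim/qind=> g.
  rewrite [_ + _]qpi_add !qpi_tens [_ + _]qpi_add.
  by apply/qpiP/(mc_tensDl EP).
- move=> a b c d; elim/qind=> f; elim/qind=> g; elim/qind=> g'.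
  rewrite [_ + _]qpi_add !qpi_tens [_ + _]qpi_add.
  by apply/qpiP/(mc_tensDr EP).
- move=> a b c d k; elim/qind=> f; elim/qind=> g.
  rewrite [_ *: _]qpi_scale !qpi_tens [_ *: _]qpi_scale.
  by apply/qpiP/(mc_tensZl EP).
- move=> a b c d k; elim/qind=> f; elim/qind=> g.
  rewrite [_ *: _]qpi_scale !qpi_tens [_ *: _]qpi_scale.
  by apply/qpiP/(mc_tensZr EP).
Qed.

Definition quotient_cat : moncat := Moncat quotient_congr.

Definition quotient_proj a b (f : P a b) : quotient_cat a b := qpi f.

End Quotient.

Record tensor_ideal (C : moncat) := TensorIdeal {
  ideal_mem :> forall a b, C a b -> Prop;
  ideal0 : forall a b, ideal_mem (0 : C a b);
  idealD : forall a b (f g : C a b),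
    ideal_mem f -> ideal_mem g -> ideal_mem (f + g);
  idealZ : forall a b k (f : C a b), ideal_mem f -> ideal_mem (k *: f);
  ideal_compl : forall a b c (g : C b c) (f : C a b),
    ideal_mem f -> ideal_mem (g ∘ f);
  ideal_compr : forall a b c (g : C b c) (f : C a b),
    ideal_mem g -> ideal_mem (g ∘ f);
  ideal_tensl : forall a b c d (f : C a b) (g : C c d),
    ideal_mem g -> ideal_mem (f ⊗ g);
  ideal_tensr : forall a b c d (f : C a b) (g : C c d),
    ideal_mem f -> ideal_mem (f ⊗ g) }.

Section IdealQuotient.
Variables (C : moncat) (I : tensor_ideal C).

Definition ideal_rel : hom_rel (raw C) := fun a b (f g : C a b) => I a b (f - g).

Lemma ideal_rel_refl a b (f : C a b) : ideal_rel f f.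
Proof. by rewrite /ideal_rel subrr; apply: ideal0. Qed.

Lemma ideal_rel_eq a b (f g : C a b) : f = g -> ideal_rel f g.
Proof. by move=> ->; apply: ideal_rel_refl. Qed.

Lemma idealN a b (f : C a b) : I a b f -> I a b (- f).
Proof. by rewrite -scaleN1r; apply: idealZ. Qed.

Lemma ideal_rel_congr : moncat_congr ideal_rel.
Proof.
split.
- exact: ideal_rel_refl.
- by move=> a b f g /idealN; rewrite /ideal_rel opprB.
- by move=> a b f g h fg gh; rewrite /ideal_rel -(subrKA g); apply: idealD.
- by move=> a b f f' g g' ff' gg'; rewrite /ideal_rel /= opprD addrACA; apply: idealD.
- by move=> a b k f f' ff'; rewrite /ideal_rel /= -scalerBr; apply: idealZ.
- move=> a b c g g' f f' gg' ff'; rewrite /ideal_rel /= -(subrKA (g' ∘ f)).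
  apply: idealD; first by rewrite -compBl; apply: ideal_compr.
  by rewrite -compBr; apply: ideal_compl.
- move=> a b c d f f' g g' ff' gg'; rewrite /ideal_rel /= -(subrKA (f' ⊗ g)).
  apply: idealD; first by rewrite -tensBl; apply: ideal_tensr.
  by rewrite -tensBr; apply: ideal_tensl.
- by move=> *; apply/ideal_rel_eq/(mc_addA (moncatP C)).
- by move=> *; apply/ideal_rel_eq/(mc_addC (moncatP C)).
- by move=> *; apply/ideal_rel_eq/(mc_add0 (moncatP C)).
- by move=> *; apply/ideal_rel_eq/(mc_addN (moncatP C)).
- by move=> *; apply/ideal_rel_eq/(mc_scaleA (moncatP C)).
- by move=> *; apply/ideal_rel_eq/(mc_scale1 (moncatP C)).
- by move=> *; apply/ideal_rel_eq/(mc_scaleDr (moncatP C)).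
- by move=> *; apply/ideal_rel_eq/(mc_scaleDl (moncatP C)).
- by move=> *; apply/ideal_rel_eq/(mc_compA (moncatP C)).
- by move=> *; apply/ideal_rel_eq/(mc_comp1l (moncatP C)).
- by move=> *; apply/ideal_rel_eq/(mc_comp1r (moncatP C)).
- by move=> *; apply/ideal_rel_eq/(mc_compDl (moncatP C)).
- by move=> *; apply/ideal_rel_eq/(mc_compDr (moncatP C)).
- by move=> *; apply/ideal_rel_eq/(mc_compZl (moncatP C)).
- by move=> *; apply/ideal_rel_eq/(mc_compZr (moncatP C)).
- by move=> *; apply/ideal_rel_eq/(mc_tens1 (moncatP C)).
- by move=> *; apply/ideal_rel_eq/(mc_tens_comp (moncatP C)).
- by move=> *; apply/ideal_rel_eq/(mc_tensA (moncatP C)).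
- by move=> *; apply/ideal_rel_eq/(mc_tens1l (moncatP C)).
- by move=> *; apply/ideal_rel_eq/(mc_tens1r (moncatP C)).
- by move=> *; apply/ideal_rel_eq/(mc_tensDl (moncatP C)).
- by move=> *; apply/ideal_rel_eq/(mc_tensDr (moncatP C)).
- by move=> *; apply/ideal_rel_eq/(mc_tensZl (moncatP C)).
- by move=> *; apply/ideal_rel_eq/(mc_tensZr (moncatP C)).
Qed.

Definition quot_cat : moncat := quotient_cat ideal_rel_congr.

Definition quot_im a b (f : C a b) : quot_cat a b :=
  quotient_proj ideal_rel_congr f.

End IdealQuotient.

Inductive Tterm : nat -> nat -> Type :=
| Tm : Tterm 2 1
| Tsigp : Tterm 2 2
| Tsigm : Tterm 2 2
| Tcup : Tterm 0 2
| Tcap : Tterm 2 0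
| Tzero a b : Tterm a b
| Tadd a b of Tterm a b & Tterm a b : Tterm a b
| Tscale a b of Qq & Tterm a b : Tterm a b
| Tid a : Tterm a a
| Tcomp a b c of Tterm b c & Tterm a b : Tterm a c
| Ttens a b c d of Tterm a b & Tterm c d : Tterm (a + c)%N (b + d)%N.

Definition term_raw : raw_moncat :=
  @RawMoncat Tterm Tzero Tadd Tscale Tid Tcomp Ttens.

Section Relations.

Local Notation "g ∘ f" := (Tcomp g f).
Local Notation "f ⊗ g" := (Ttens f g).
Local Notation id1 := (Tid 1).
Local Notation m := Tm.
Local Notation "σ₊" := Tsigp.
Local Notation "σ₋" := Tsigm.
Local Notation "∪" := Tcup.
Local Notation "∩" := Tcap.
Local Notation s := ((id1 ⊗ m) ∘ (∪ ⊗ id1) : Tterm 1 2).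

Record T_relations (E : hom_rel Tterm) : Prop := TRelations {
  R1l : E 1%N 1%N ((∩ ⊗ id1) ∘ (id1 ⊗ ∪)) id1;
  R1r : E 1%N 1%N ((id1 ⊗ ∩) ∘ (∪ ⊗ id1)) id1;
  R2 : E 1%N 2%N ((id1 ⊗ m) ∘ (∪ ⊗ id1)) ((m ⊗ id1) ∘ (id1 ⊗ ∪));
  R3l : E 3%N 1%N ((id1 ⊗ ∩) ∘ (σ₋ ⊗ id1)) ((∩ ⊗ id1) ∘ (id1 ⊗ σ₊));
  R3r : E 3%N 1%N ((id1 ⊗ ∩) ∘ (σ₊ ⊗ id1)) ((∩ ⊗ id1) ∘ (id1 ⊗ σ₋));
  R4l : E 2%N 2%N (σ₋ ∘ σ₊) (Tid 2);
  R4r : E 2%N 2%N (σ₊ ∘ σ₋) (Tid 2);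
  R5 : E 3%N 3%N ((σ₊ ⊗ id1) ∘ (id1 ⊗ σ₊) ∘ (σ₊ ⊗ id1))
             ((id1 ⊗ σ₊) ∘ (σ₊ ⊗ id1) ∘ (id1 ⊗ σ₊));
  R6 : E 3%N 2%N ((id1 ⊗ m) ∘ (σ₊ ⊗ id1) ∘ (id1 ⊗ σ₊)) (σ₊ ∘ (m ⊗ id1));
  R7 : E 2%N 3%N ((id1 ⊗ σ₊) ∘ (σ₊ ⊗ id1) ∘ (id1 ⊗ s)) ((s ⊗ id1) ∘ σ₊);
  R8_twist : E 2%N 0%N (∩ ∘ σ₊) (Tscale beta ∩);
  R8_vertex : E 2%N 1%N (m ∘ σ₊) (Tscale tau m);
  R8_bubble : E 1%N 1%N (m ∘ s) (Tscale phi id1);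
  R8_loop : E 0%N 0%N (∩ ∘ ∪) (Tscale delta (Tid 0));
  R8_lollipop : E 0%N 1%N (m ∘ ∪) (Tzero 0 1) }.

End Relations.

Definition T_rel : hom_rel term_raw := fun a b f g =>
  forall E : hom_rel term_raw, moncat_congr E -> T_relations E -> E a b f g.

Lemma T_rel_law a b (f g : term_raw a b) :
  (forall E : hom_rel term_raw, moncat_congr E -> E a b f g) -> T_rel f g.
Proof. by move=> law E EP _; apply: law. Qed.

Lemma T_rel_congr : moncat_congr T_rel.
Proof.
split.
- by move=> a b f E EP _; apply: (mc_refl EP).
- by move=> a b f g fg E EP ER; apply: (mc_sym EP); apply: fg.
- by move=> a b f g h fg gh E EP ER; apply: (mc_trans EP); [apply: fg|apply: gh].
- by move=> a b f f' g g' ff gg E EP ER; apply: (mc_add EP); [apply: ff|apply: gg].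
- by move=> a b k f f' ff E EP ER; apply: (mc_scale EP); apply: ff.
- by move=> a b c g g' f f' gg ff E EP ER; apply: (mc_comp EP); [apply: gg|apply: ff].
- by move=> a b c d f f' g g' ff gg E EP ER; apply: (mc_tens EP); [apply: ff|apply: gg].
- by move=> *; apply: T_rel_law => E EP; apply: (mc_addA EP).
- by move=> *; apply: T_rel_law => E EP; apply: (mc_addC EP).
- by move=> *; apply: T_rel_law => E EP; apply: (mc_add0 EP).
- by move=> *; apply: T_rel_law => E EP; apply: (mc_addN EP).
- by move=> *; apply: T_rel_law => E EP; apply: (mc_scaleA EP).
- by move=> *; apply: T_rel_law => E EP; apply: (mc_scale1 EP).
- by move=> *; apply: T_rel_law => E EP; apply: (mc_scaleDr EP).
- by move=> *; apply: T_rel_law => E EP; apply: (mc_scaleDl EP).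
- by move=> *; apply: T_rel_law => E EP; apply: (mc_compA EP).
- by move=> *; apply: T_rel_law => E EP; apply: (mc_comp1l EP).
- by move=> *; apply: T_rel_law => E EP; apply: (mc_comp1r EP).
- by move=> *; apply: T_rel_law => E EP; apply: (mc_compDl EP).
- by move=> *; apply: T_rel_law => E EP; apply: (mc_compDr EP).
- by move=> *; apply: T_rel_law => E EP; apply: (mc_compZl EP).
- by move=> *; apply: T_rel_law => E EP; apply: (mc_compZr EP).
- by move=> *; apply: T_rel_law => E EP; apply: (mc_tens1 EP).
- by move=> *; apply: T_rel_law => E EP; apply: (mc_tens_comp EP).
- by move=> *; apply: T_rel_law => E EP; apply: (mc_tensA EP).
- by move=> *; apply: T_rel_law => E EP; apply: (mc_tens1l EP).
- by move=> *; apply: T_rel_law => E EP; apply: (mc_tens1r EP).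
- by move=> *; apply: T_rel_law => E EP; apply: (mc_tensDl EP).
- by move=> *; apply: T_rel_law => E EP; apply: (mc_tensDr EP).
- by move=> *; apply: T_rel_law => E EP; apply: (mc_tensZl EP).
- by move=> *; apply: T_rel_law => E EP; apply: (mc_tensZr EP).
Qed.

Lemma T_rel_relations : T_relations T_rel.
Proof. by split=> E EP ER; apply ER. Qed.

Definition T : moncat := quotient_cat T_rel_congr.

Definition T_of a b (t : Tterm a b) : T a b := quotient_proj T_rel_congr t.

Definition m : mor T 2 1 := T_of Tm.
Definition sigp : mor T 2 2 := T_of Tsigp.
Definition sigm : mor T 2 2 := T_of Tsigm.
Definition cup : mor T 0 2 := T_of Tcup.
Definition cap : mor T 2 0 := T_of Tcap.

Definition s : mor T 1 2 := (mid 1 ⊗ m) ∘ (cup ⊗ mid 1).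

Definition U : mor T 2 2 := cup ∘ cap.
Definition H : mor T 2 2 := (m ⊗ mid 1) ∘ (mid 1 ⊗ s).
Definition N : mor T 2 2 := s ∘ m.
Definition Sq : mor T 2 2 := H ∘ H.

Definition is_basis (V : lmodType Qq) (n : nat) (b : n.-tuple V) : Prop :=
  forall v : V, exists! c : 'rV[Qq]_n, v = \sum_(i < n) c 0 i *: tnth b i.

(* Main.v *)
(* Let Rot be rotation by a quarter turn on A = End(I^2). It swaps 1 with U, H with N
   and sigma_+ with sigma_-, so Rot^2 is the identity on the given basis of A; since
   Rot^2 is an anti-automorphism, A is commutative. By Rot-antisymmetry,
   sigma_+ - sigma_- = a (1 - U) + c (H - N), and S = H^2 is Rot-invariant, so
   S = w (1 + U) + x (sigma_+ + sigma_-) + y (H + N).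

   Sliding a vertex through a strand gives Rot(sigma_+ H) = tau H sigma_-. Applied to the
   skein relation times H, this yields a quartic equation for sigma_+ modulo the ideal
   spanned by U and N. The quotient by that ideal is 3-dimensional and generated by
   sigma_+, hence the quartic is the minimal cubic times a linear factor X - s.
   The eigenvalues of U and N on S (two further equations) reduce everything to
   (s - tau) (s + 1/tau) (s^3 - tau^2) = 0, of which only s^3 = tau^2 survives, that is
   s = q^8 because Q(q) has no primitive cube root of unity. All coefficients are
   rational functions of s. *)
From HB Require Import structures.
Require Import Defs.
From mathcomp Require Import all_boot all_order all_algebra boolp ring.

Set Implicit Arguments.
Unset Strict Implicit.
Unset Printing Implicit Defensive.
Import Order.TTheory GRing.Theory Num.Theory.

Local Open Scope ring_scope.
Local Open Scope moncat_scope.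

(** * Planar calculus *)

Section MonoidalCategory.
Variable C : moncat.

Lemma mcompA a b c d (h : C c d) (g : C b c) (f : C a b) :
  h ∘ (g ∘ f) = h ∘ g ∘ f.
Proof. exact: (mc_compA (moncatP C)). Qed.
Lemma comp1f a b (f : C a b) : mid b ∘ f = f.
Proof. exact: (mc_comp1l (moncatP C)). Qed.
Lemma compf1 a b (f : C a b) : f ∘ mid a = f.
Proof. exact: (mc_comp1r (moncatP C)). Qed.
Lemma compDl a b c (g g' : C b c) (f : C a b) : (g + g') ∘ f = g ∘ f + g' ∘ f.
Proof. exact: (mc_compDl (moncatP C)). Qed.
Lemma compDr a b c (g : C b c) (f f' : C a b) : g ∘ (f + f') = g ∘ f + g ∘ f'.
Proof. exact: (mc_compDr (moncatP C)). Qed.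
Lemma compZl a b c k (g : C b c) (f : C a b) : (k *: g) ∘ f = k *: (g ∘ f).
Proof. exact: (mc_compZl (moncatP C)). Qed.
Lemma compZr a b c k (g : C b c) (f : C a b) : g ∘ (k *: f) = k *: (g ∘ f).
Proof. exact: (mc_compZr (moncatP C)). Qed.
Lemma comp0f a b c (f : C a b) : (0 : C b c) ∘ f = 0.
Proof. by rewrite -(scale0r (0 : C b c)) compZl scale0r. Qed.
Lemma compf0 a b c (g : C b c) : g ∘ (0 : C a b) = 0.
Proof. by rewrite -(scale0r (0 : C a b)) compZr scale0r. Qed.
Lemma tensDl a b c d (f f' : C a b) (g : C c d) : (f + f') ⊗ g = f ⊗ g + f' ⊗ g.
Proof. exact: (mc_tensDl (moncatP C)). Qed.
Lemma tensDr a b c d (f : C a b) (g g' : C c d) : f ⊗ (g + g') = f ⊗ g + f ⊗ g'.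
Proof. exact: (mc_tensDr (moncatP C)). Qed.
Lemma tensZl a b c d k (f : C a b) (g : C c d) : (k *: f) ⊗ g = k *: (f ⊗ g).
Proof. exact: (mc_tensZl (moncatP C)). Qed.
Lemma tensZr a b c d k (f : C a b) (g : C c d) : f ⊗ (k *: g) = k *: (f ⊗ g).
Proof. exact: (mc_tensZr (moncatP C)). Qed.
Lemma tens_comp a b c a' b' c' (g : C b c) (f : C a b) (g' : C b' c') (f' : C a' b') :
  (g ∘ f) ⊗ (g' ∘ f') = (g ⊗ g') ∘ (f ⊗ f').
Proof. exact: (mc_tens_comp (moncatP C)). Qed.
Lemma tens11 a b : mid a ⊗ mid b = mid (a + b)%N :> C _ _.
Proof. exact: (mc_tens1 (moncatP C)). Qed.
Lemma tens1f a b (f : C a b) : mid 0 ⊗ f = f.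
Proof. exact: (mc_tens1l (moncatP C)). Qed.

(* The equations between objects are arguments: on numerals they hold by
   [erefl], and then the casts vanish. *)
Lemma tensA a b c d e x (f : C a b) (g : C c d) (h : C e x)
    (ea : (a + (c + e) = a + c + e)%N) (eb : (b + (d + x) = b + d + x)%N) :
  cast (X := fun a b => C a b) ea eb (f ⊗ (g ⊗ h)) = f ⊗ g ⊗ h.
Proof.
rewrite (eq_irrelevance ea (addnA a c e)) (eq_irrelevance eb (addnA b d x)).
exact: (mc_tensA (moncatP C)).
Qed.
Lemma tensf1 a b (f : C a b) (ea : (a + 0 = a)%N) (eb : (b + 0 = b)%N) :
  cast (X := fun a b => C a b) ea eb (f ⊗ mid 0) = f.
Proof.
rewrite (eq_irrelevance ea (addn0 a)) (eq_irrelevance eb (addn0 b)).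
exact: (mc_tens1r (moncatP C)).
Qed.

Lemma tens_compl a b c n (g : C b c) (f : C a b) :
  mid n ⊗ (g ∘ f) = (mid n ⊗ g) ∘ (mid n ⊗ f).
Proof. by rewrite -tens_comp comp1f. Qed.
Lemma tens_compr a b c n (g : C b c) (f : C a b) :
  (g ∘ f) ⊗ mid n = (g ⊗ mid n) ∘ (f ⊗ mid n).
Proof. by rewrite -tens_comp comp1f. Qed.
Lemma tens_lr a b c d (f : C a b) (g : C c d) :
  (f ⊗ mid d) ∘ (mid a ⊗ g) = (mid b ⊗ g) ∘ (f ⊗ mid c).
Proof. by rewrite -!tens_comp !comp1f !compf1. Qed.

Local Notation assoc f g h :=
  (tensA f g h erefl erefl : f ⊗ (g ⊗ h) = f ⊗ g ⊗ h).
Local Notation unitr f := (tensf1 f erefl erefl : f ⊗ mid 0 = f).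

(** * Rotation by a quarter turn *)

Section Rotation.
Variables (cup : C 0%N 2%N) (cap : C 2%N 0%N).
Hypothesis zigl : (cap ⊗ mid 1) ∘ (mid 1 ⊗ cup) = mid 1 :> C 1%N 1%N.
Hypothesis zigr : (mid 1 ⊗ cap) ∘ (cup ⊗ mid 1) = mid 1 :> C 1%N 1%N.

(** The clockwise quarter turn, Rot of the overview: [cup] bends the lower left leg of [f] up, [cap]
    bends its upper right leg down. *)
Definition turn (f : C 2%N 2%N) : C 2%N 2%N :=
  (mid 2 ⊗ cap) ∘ (mid 1 ⊗ f ⊗ mid 1) ∘ (cup ⊗ mid 2).

(** This form and [turn_cupE] isolate [f] together with one bend, which is where relations for
    sliding past a cap or a cup apply. *)
Lemma turn_capE f :
  turn f = (mid 1 ⊗ ((mid 1 ⊗ cap) ∘ (f ⊗ mid 1))) ∘ (cup ⊗ mid 2).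
Proof.
rewrite /turn tens_compl; congr (_ ∘ _ ∘ _).
  by rewrite (assoc (mid 1) (mid 1) cap) tens11.
by rewrite (assoc (mid 1) f (mid 1)).
Qed.

Lemma turn_cupE f :
  turn f = (mid 2 ⊗ cap) ∘ (((mid 1 ⊗ f) ∘ (cup ⊗ mid 1)) ⊗ mid 1).
Proof.
rewrite /turn tens_compr mcompA; congr (_ ∘ _).
by rewrite -(assoc cup (mid 1) (mid 1)) tens11.
Qed.

Lemma turnD f g : turn (f + g) = turn f + turn g.
Proof. by rewrite /turn tensDr tensDl compDr compDl. Qed.
Lemma turnZ k f : turn (k *: f) = k *: turn f.
Proof. by rewrite /turn tensZr tensZl compZr compZl. Qed.

Lemma turn1 : turn (mid 2) = cup ∘ cap.
Proof.
rewrite turn_capE tens11 compf1 (assoc (mid 1) (mid 1) cap) tens11.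
by rewrite -(tens_lr cup cap) (unitr cup) tens1f.
Qed.

Lemma turnU : turn (cup ∘ cap) = mid 2.
Proof.
rewrite turn_capE tens_compr mcompA zigr comp1f -(tens11 1 1).
rewrite (assoc cup (mid 1) (mid 1)) (assoc (mid 1) cap (mid 1)).
by rewrite -(tens_compr 1 (mid 1 ⊗ cap) (cup ⊗ mid 1)) zigr tens11.
Qed.

Section Crossing.
Variables (f g : C 2%N 2%N).
Hypothesis slide : (mid 1 ⊗ cap) ∘ (f ⊗ mid 1) = (cap ⊗ mid 1) ∘ (mid 1 ⊗ g).

(** After [f] has passed the cap as [g], the remaining cup and cap form a zigzag beside [g] and
    straighten. *)
Lemma turn_slide : turn f = g.
Proof.
rewrite turn_capE slide tens_compl (assoc (mid 1) (mid 1) g) tens11 -mcompA.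
rewrite -(tens_lr cup g) tens1f mcompA.
rewrite (assoc (mid 1) cap (mid 1)) -(tens11 1 1) (assoc cup (mid 1) (mid 1)).
by rewrite -(tens_compr 1 (mid 1 ⊗ cap) (cup ⊗ mid 1)) zigr tens11 comp1f.
Qed.
End Crossing.

(** * Rotation of diagrams built from the trivalent vertex *)

Section Vertex.
Variables (m : C 2%N 1%N) (s : C 1%N 2%N) (H : C 2%N 2%N).
Hypothesis sEr : s = (mid 1 ⊗ m) ∘ (cup ⊗ mid 1).
Hypothesis sEl : s = (m ⊗ mid 1) ∘ (mid 1 ⊗ cup).
Hypothesis HE : H = (m ⊗ mid 1) ∘ (mid 1 ⊗ s).

Lemma merge_capr : (mid 1 ⊗ cap) ∘ (s ⊗ mid 1) = m.
Proof.
rewrite sEl tens_compr mcompA -(assoc m (mid 1) (mid 1)) tens11.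
rewrite -(tens_lr m cap) (unitr m) -mcompA -(assoc (mid 1) cup (mid 1)).
rewrite -(tens11 1 1) -(assoc (mid 1) (mid 1) cap).
by rewrite -(tens_compl 1 (mid 1 ⊗ cap) (cup ⊗ mid 1)) zigr tens11 compf1.
Qed.

Lemma merge_capl : (cap ⊗ mid 1) ∘ (mid 1 ⊗ s) = m.
Proof.
rewrite sEr tens_compl mcompA (assoc (mid 1) (mid 1) m) tens11 (tens_lr cap m) tens1f.
rewrite -mcompA (assoc (mid 1) cup (mid 1)) -(tens11 1 1) (assoc cap (mid 1) (mid 1)).
by rewrite -(tens_compr 1 (cap ⊗ mid 1) (mid 1 ⊗ cup)) zigl tens11 compf1.
Qed.

(** When [s] is opened as a cup followed by [m], the two vertices act on disjoint strands.
    Exchanging their heights lets the other form of [s] close up on the left. *)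
Lemma H_leftE : H = (mid 1 ⊗ m) ∘ (s ⊗ mid 1).
Proof.
rewrite HE [in LHS]sEr tens_compl mcompA (assoc (mid 1) (mid 1) m) tens11 (tens_lr m m).
rewrite -mcompA -(tens11 1 1) (assoc m (mid 1) (mid 1)) (assoc (mid 1) cup (mid 1)).
by rewrite -(tens_compr 1 (m ⊗ mid 1) (mid 1 ⊗ cup)) -sEl.
Qed.

(** Cyclic symmetry of the vertex: opening [m] as a bent [s] turns both sides into two caps side by
    side over an [s] on the middle strand. *)
Lemma cap_merge : cap ∘ (m ⊗ mid 1) = cap ∘ (mid 1 ⊗ m).
Proof.
rewrite -[in LHS]merge_capl -[in RHS]merge_capr (tens_compr 1 (cap ⊗ mid 1))
  (tens_compl 1 (mid 1 ⊗ cap)) !mcompA.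
rewrite -(assoc cap (mid 1) (mid 1)) (assoc (mid 1) (mid 1) cap) !tens11.
rewrite -{1}[cap]tens1f -(tens_lr cap cap) (unitr cap).
by rewrite (assoc (mid 1) s (mid 1)).
Qed.

(** Cyclic symmetry moves the upper vertex of [H] across the cap, onto the lower one, where the two
    form a bubble. *)
Lemma cap_H k : m ∘ s = k *: mid 1 -> cap ∘ H = k *: cap.
Proof.
move=> ms.
rewrite H_leftE mcompA -cap_merge -mcompA -(tens_compr 1 m s) ms.
by rewrite tensZl tens11 compZr compf1.
Qed.

Lemma H_cup : (mid 1 ⊗ H) ∘ (cup ⊗ mid 1) = (s ⊗ mid 1) ∘ s.
Proof.
rewrite HE tens_compl (assoc (mid 1) (mid 1) s) tens11 -mcompA -(tens_lr cup s).
rewrite tens1f mcompA (assoc (mid 1) m (mid 1)) -(tens11 1 1).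
by rewrite (assoc cup (mid 1) (mid 1)) -(tens_compr 1 (mid 1 ⊗ m) (cup ⊗ mid 1)) -sEr.
Qed.

Lemma cap_H_right : (mid 1 ⊗ cap) ∘ (H ⊗ mid 1) = m ∘ (mid 1 ⊗ m).
Proof.
rewrite HE tens_compr mcompA -(assoc m (mid 1) (mid 1)) tens11 -(tens_lr m cap) (unitr m).
rewrite -mcompA -(tens11 1 1) -(assoc (mid 1) (mid 1) cap) -(assoc (mid 1) s (mid 1)).
by rewrite -(tens_compl 1 (mid 1 ⊗ cap) (s ⊗ mid 1)) merge_capr.
Qed.

Lemma turnH : turn H = s ∘ m.
Proof.
rewrite turn_cupE H_cup tens_compr mcompA -(assoc s (mid 1) (mid 1)) tens11.
by rewrite -(tens_lr s cap) (unitr s) -mcompA merge_capr.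
Qed.

Lemma turnN : turn (s ∘ m) = H.
Proof.
rewrite turn_capE tens_compr mcompA merge_capr tens_compl -mcompA H_leftE.
congr (_ ∘ _).
rewrite (assoc (mid 1) m (mid 1)) -(tens11 1 1) (assoc cup (mid 1) (mid 1)).
by rewrite -(tens_compr 1 (mid 1 ⊗ m) (cup ⊗ mid 1)) -sEr.
Qed.

Lemma cup_H_right : (mid 1 ⊗ (H ⊗ mid 1)) ∘ (cup ⊗ mid 2) =
  (s ⊗ mid 2) ∘ (s ⊗ mid 1).
Proof.
rewrite (assoc (mid 1) H (mid 1)) -(tens11 1 1) (assoc cup (mid 1) (mid 1)).
rewrite -(tens_compr 1 (mid 1 ⊗ H) (cup ⊗ mid 1)) H_cup tens_compr.
by rewrite -(assoc s (mid 1) (mid 1)).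
Qed.

(** The cap is absorbed by the upper [H] and the cup by the lower one; the four vertices that remain
    regroup into two copies of [H] by [H_leftE]. *)
Lemma turnS : turn (H ∘ H) = H ∘ H.
Proof.
rewrite turn_capE tens_compr mcompA cap_H_right tens_compl -mcompA cup_H_right.
rewrite tens_compl (assoc (mid 1) (mid 1) m) tens11 -!mcompA.
rewrite (mcompA (mid 2 ⊗ m)) -(tens_lr s m) -!mcompA -H_leftE mcompA.
by rewrite -H_leftE.
Qed.

(* The second hypothesis moves the vertex of H through the strand; the twist of the other
   vertex then contributes the scalar k. *)
Lemma turn_crossH (f g : C 2%N 2%N) k :
  (mid 1 ⊗ cap) ∘ (f ⊗ mid 1) = (cap ⊗ mid 1) ∘ (mid 1 ⊗ g) ->
  (mid 1 ⊗ s) ∘ g = (g ⊗ mid 1) ∘ (mid 1 ⊗ g) ∘ (s ⊗ mid 1) ->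
  m = k *: (m ∘ g) ->
  turn (f ∘ H) = k *: (H ∘ g).
Proof.
move=> slide push mg.
rewrite turn_capE tens_compr mcompA slide -mcompA tens_compl -mcompA.
rewrite (tens_compl 1 (mid 1 ⊗ g)) -mcompA cup_H_right.
rewrite (assoc (mid 1) (mid 1) g) tens11 (mcompA (mid 2 ⊗ g)) -(tens_lr s g) mcompA.
rewrite (assoc (mid 1) cap (mid 1)) mcompA -(tens11 1 1) (assoc s (mid 1) (mid 1)).
rewrite -(tens_compr 1 (mid 1 ⊗ cap) (s ⊗ mid 1)) merge_capr.
rewrite {1}mg tensZl !compZl tens_compr HE -!mcompA; congr (_ *: (_ ∘ _)).
by rewrite push !mcompA.
Qed.

End Vertex.

(** * Half turns as transposition *)

Lemma cap_bend (f : C 3%N 1%N) :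
  (cap ⊗ mid 1) ∘ (mid 1 ⊗ ((mid 1 ⊗ f) ∘ (cup ⊗ mid 2))) = f.
Proof.
rewrite tens_compl (assoc (mid 1) (mid 1) f) tens11 mcompA (tens_lr cap f) tens1f.
rewrite -mcompA -(tens11 1 2) (assoc cap (mid 1) (mid 2)) (assoc (mid 1) cup (mid 2)).
by rewrite -(tens_compr 2 (cap ⊗ mid 1) (mid 1 ⊗ cup)) zigl tens11 compf1.
Qed.

Lemma cap_slide (f : C 2%N 2%N) :
  (mid 1 ⊗ cap) ∘ (f ⊗ mid 1) = (cap ⊗ mid 1) ∘ (mid 1 ⊗ turn f).
Proof. by rewrite turn_capE cap_bend. Qed.

(** The nested cap, that is, the evaluation pairing of I^2 with itself. *)
Definition cap2 : C 4%N 0%N := cap ∘ (mid 1 ⊗ cap ⊗ mid 1).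

Lemma cap_cap : cap ∘ (cap ⊗ mid 2) = cap ∘ (mid 2 ⊗ cap).
Proof. by rewrite -{1}[cap]tens1f -(tens_lr cap cap) (unitr cap). Qed.

(* Two quarter turns are a half turn, i.e., the transpose with respect to [cap2]; hence
   they reverse compositions. *)
Lemma cap2_slide (f : C 2%N 2%N) :
  cap2 ∘ (f ⊗ mid 2) = cap2 ∘ (mid 2 ⊗ turn (turn f)).
Proof.
rewrite /cap2 -mcompA -(tens11 1 1) (assoc f (mid 1) (mid 1)).
rewrite -(tens_compr 1 (mid 1 ⊗ cap) (f ⊗ mid 1)) cap_slide tens_compr mcompA.
rewrite -(assoc cap (mid 1) (mid 1)) tens11 cap_cap -mcompA.
rewrite -(tens11 1 1) -(assoc (mid 1) (mid 1) cap) -(assoc (mid 1) (turn f) (mid 1)).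
rewrite -(tens_compl 1 (mid 1 ⊗ cap) (turn f ⊗ mid 1)) cap_slide tens_compl.
by rewrite mcompA (assoc (mid 1) cap (mid 1)) (assoc (mid 1) (mid 1) (turn (turn f))).
Qed.

(** The pairing [cap2] is nondegenerate: the nested cup [cup2] is inverse to it, so pairing with
    [cup2] recovers the morphism. *)
Lemma cap2_inj (f g : C 2%N 2%N) :
  cap2 ∘ (mid 2 ⊗ f) = cap2 ∘ (mid 2 ⊗ g) -> f = g.
Proof.
pose cup2 : C 0%N 4%N := (mid 1 ⊗ cup ⊗ mid 1) ∘ cup.
have zig2 : (mid 2 ⊗ cap2) ∘ (cup2 ⊗ mid 2) = mid 2 :> C 2%N 2%N.
  rewrite /cap2 /cup2 tens_compl tens_compr -!mcompA.
  rewrite (mcompA (mid 2 ⊗ (mid 1 ⊗ cap ⊗ mid 1))).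
  (* The inner cup and the inner cap touch disjoint strands. With their order exchanged, the nested
     zigzag becomes two simple zigzags. *)
  have -> : (mid 2 ⊗ (mid 1 ⊗ cap ⊗ mid 1)) ∘ (mid 1 ⊗ cup ⊗ mid 1 ⊗ mid 2)
      = (mid 1 ⊗ cup ⊗ mid 1) ∘ (mid 1 ⊗ cap ⊗ mid 1) :> C 4%N 4%N.
    rewrite -(assoc (mid 1) cap (mid 1)) (assoc (mid 2) (mid 1) (cap ⊗ mid 1)).
    rewrite tens11 -(tens11 1 2) -(assoc (mid 1) (mid 2) (cap ⊗ mid 1)).
    rewrite -(assoc (mid 1) cup (mid 1)) -(assoc (mid 1) (cup ⊗ mid 1) (mid 2)).
    rewrite -(assoc cup (mid 1) (mid 2)) tens11.
    rewrite -(tens_compl 1 (mid 2 ⊗ (cap ⊗ mid 1)) (cup ⊗ mid 3)).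
    by rewrite -(tens_lr cup (cap ⊗ mid 1)) tens1f tens_compl.
  rewrite -!mcompA -(tens11 1 1) (assoc cup (mid 1) (mid 1)).
  rewrite -(tens_compr 1 (mid 1 ⊗ cap) (cup ⊗ mid 1)) zigr tens11 compf1.
  rewrite -(assoc (mid 1) cup (mid 1)) -(tens11 1 1) -(assoc (mid 1) (mid 1) cap).
  by rewrite -(tens_compl 1 (mid 1 ⊗ cap) (cup ⊗ mid 1)) zigr tens11.
move=> /(congr1 (fun h => (mid 2 ⊗ h) ∘ (cup2 ⊗ mid 2))).
have E h : (mid 2 ⊗ (cap2 ∘ (mid 2 ⊗ h))) ∘ (cup2 ⊗ mid 2) = h.
  rewrite tens_compl (assoc (mid 2) (mid 2) h) tens11 -mcompA -(tens_lr cup2 h).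
  by rewrite tens1f mcompA zig2 comp1f.
by rewrite !E.
Qed.

Lemma turn_turn_comp (f g : C 2%N 2%N) :
  turn (turn (f ∘ g)) = turn (turn g) ∘ turn (turn f).
Proof.
apply: cap2_inj; rewrite -cap2_slide tens_compr mcompA cap2_slide -mcompA.
rewrite -(tens_lr g (turn (turn f))) mcompA cap2_slide -mcompA.
by rewrite -(tens_compl 2 (turn (turn g))).
Qed.

End Rotation.
End MonoidalCategory.

(** * The scalar equations *)

Section EigenSystem.
Variable F : fieldType.

(* With s1, s2, s3 the eigenvalues of sigma_+ on A/(U, N), the f_i are their elementary
   symmetric functions, with f3 = tau / s, and s is the fourth root of the quartic
   satisfied by sigma_+. Moreover Phi = c phi, Theta = c t where m H = t m, and
   (W, X, Y) = (c^2 w, c^2 x, c y): scaling by c removes H from the unknowns. *)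
Record eigen_system (tau delta a s f1 f2 Phi Theta W X Y : F) : Prop := EigenSystem {
  es_Phi : Phi = tau ^+ 2 - (tau ^+ 2)^-1 - a * (1 - delta);
  es_Theta : Theta = tau - tau^-1 - a + Phi;
  es_quartic3 : (1 + tau^-1) * (f1 - a) + (1 + tau) * (s / tau) = a + Theta;
  es_quartic1 : (1 + tau^-1) * (tau / s) + (1 + tau) * (f2 * (s / tau) + a) = - (a + Theta);
  es_quartic2 : (1 + tau^-1) * (- f2 - 1) - (1 + tau) * (1 + f1 * (s / tau)) =
    a * Phi - a * (a + Theta);
  es_square1 : W - a * Y = - f2 - 2 - f1 * (s / tau) + a ^+ 2;
  es_squarep : X + Y = f1 + s / tau - 2 * a;
  es_squarem : X - Y = tau / s + f2 * (s / tau) + 2 * a;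
  es_cap : Phi ^+ 2 = W * (1 + delta) + X * (tau ^+ 2 + (tau ^+ 2)^-1) + Y * Phi;
  es_merge : Theta ^+ 2 = W + X * (tau + tau^-1) + Y * (Theta + Phi) }.

Variables tau delta a s f1 f2 Phi Theta W X Y : F.
Hypothesis sys : eigen_system tau delta a s f1 f2 Phi Theta W X Y.
Hypotheses (two0 : 2 != 0 :> F) (tau0 : tau != 0) (s0 : s != 0).
Hypothesis taup1 : tau + 1 != 0.

(** All equations used up to [W_formula] are linear in the unknown solved for; together they leave
    [a] and [s] as the only unknowns. *)
Lemma f1_formula : f1 = a - s + tau * (a + Theta) / (tau + 1).
Proof.
have -> : f1 = a - s + tau * ((1 + tau^-1) * (f1 - a) + (1 + tau) * (s / tau)) / (tau + 1).
  by field; rewrite tau0 taup1.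
by rewrite (es_quartic3 sys).
Qed.

Lemma f2_formula : f2 = (- tau * a - tau / s - tau * (a + Theta) / (tau + 1)) / s.
Proof.
have -> : f2 = (- tau * a - tau / s
    + tau * ((1 + tau^-1) * (tau / s) + (1 + tau) * (f2 * (s / tau) + a)) / (tau + 1)) / s.
  by field; rewrite tau0 taup1 s0.
by rewrite (es_quartic1 sys); field; rewrite taup1 s0.
Qed.

Lemma X_formula : X = (f1 + s / tau + tau / s + f2 * (s / tau)) / 2.
Proof.
have -> : X = ((X + Y) + (X - Y)) / 2 by field.
by rewrite (es_squarep sys) (es_squarem sys); field; rewrite two0 tau0 s0.
Qed.

Lemma Y_formula : Y = (f1 + s / tau - tau / s - f2 * (s / tau)) / 2 - 2 * a.
Proof.
have -> : Y = ((X + Y) - (X - Y)) / 2 by field.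
by rewrite (es_squarep sys) (es_squarem sys); field; rewrite two0 tau0 s0.
Qed.

Lemma W_formula : W = a * Y - f2 - 2 - f1 * (s / tau) + a ^+ 2.
Proof. by rewrite -[W](subrK (a * Y)) (es_square1 sys); ring. Qed.

(** [D] is, up to the factor [s], the coefficient of [a] in [quartic_factors]. [V] and [Z] below are
    the defects of [es_cap] and [es_merge]; they vanish, but as expressions they can be factored. *)
Let D := (1 + tau * delta) * s - tau ^+ 2 - tau * delta.
Let V := Phi ^+ 2 - (W * (1 + delta) + X * (tau ^+ 2 + (tau ^+ 2)^-1) + Y * Phi).
Let Z := Theta ^+ 2 - (W + X * (tau + tau^-1) + Y * (Theta + Phi)).

(** By [es_Theta] the product of [a] and [Phi] cancels in [es_quartic2], so that the equation
    becomes linear in [a] once [f1] and [f2] are substituted. *)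
Lemma quartic_factors :
  (s + 1) * (a * s * D - (tau + 1) * (s - 1) * (s - tau ^+ 2) * (s + tau^-1)) = 0.
Proof.
transitivity (- (s ^+ 2 * tau) * ((1 + tau^-1) * (- f2 - 1)
    - (1 + tau) * (1 + f1 * (s / tau)) - (a * Phi - a * (a + Theta)))).
  rewrite f1_formula f2_formula (es_Theta sys) (es_Phi sys) /D.
  by field; rewrite tau0 taup1 s0.
by rewrite (es_quartic2 sys) subrr mulr0.
Qed.

(** A triangular system: each right-hand side involves only unknowns solved for later in the list,
    so rewriting ends in a rational function of [a], [s], [tau] and [delta]. *)
Let solved := (W_formula, Y_formula, X_formula, f1_formula, f2_formula, es_Theta sys, es_Phi sys).

Hypotheses (taum1 : tau - 1 != 0) (delta0 : delta != 0) (Phi0 : Phi != 0).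
Hypothesis td : tau * delta + tau ^+ 2 - tau + 1 != 0.
Hypothesis tau5 : tau ^+ 4 - tau ^+ 3 + tau ^+ 2 - tau + 1 != 0.

(* At s = -1 the linear equation for a is void, but then [es_cap] forces Phi = 0. *)
Lemma s_neqN1 : s != -1.
Proof.
have V0 : V = 0 by rewrite /V (es_cap sys) subrr.
apply/eqP=> sE; have : delta * (tau - 1) * Phi = 0.
  have -> : delta * (tau - 1) * Phi = (tau + 1) * V.
    rewrite /V !solved sE.
    by field; rewrite two0 tau0 taup1 oppr_eq0 oner_eq0.
  by rewrite V0 mulr0.
by apply/eqP; rewrite !mulf_eq0 (negPf delta0) (negPf taum1) (negPf Phi0).
Qed.

(** If [D] vanished, then by [quartic_factors] [s] would be 1, [tau ^+ 2] or [- tau^-1]; the values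
    of [D] at these three points are products of nonzero factors. *)
Lemma a_formula :
  D != 0 /\ a = (tau + 1) * (s - 1) * (s - tau ^+ 2) * (s + tau^-1) / (s * D).
Proof.
move/eqP: quartic_factors; rewrite mulf_eq0 addr_eq0 (negPf s_neqN1) subr_eq0 /= => /eqP L.
suff D0 : D != 0 by split=> //; rewrite -L; field; rewrite s0 D0.
apply/eqP=> DE; move: L; rewrite DE mulr0 => /esym/eqP.
rewrite !mulf_eq0 (negPf taup1) /= subr_eq0 subr_eq0 addr_eq0 -orbA.
case/or3P=> /eqP sE; move/eqP: DE; apply/negP; rewrite /D sE.
- have -> : (1 + tau * delta) * 1 - tau ^+ 2 - tau * delta = - ((tau - 1) * (tau + 1)).
    by ring.
  by rewrite oppr_eq0 mulf_neq0.
- have -> : (1 + tau * delta) * tau ^+ 2 - tau ^+ 2 - tau * delta =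
      tau * delta * ((tau - 1) * (tau + 1)) by ring.
  by rewrite !mulf_neq0.
- have -> : (1 + tau * delta) * - tau^-1 - tau ^+ 2 - tau * delta =
      - ((tau + 1) * (tau * delta + tau ^+ 2 - tau + 1) / tau) by field.
  by rewrite oppr_eq0 !mulf_neq0 ?invr_eq0.
Qed.

(** With [a] substituted, [es_cap] becomes a product in [s]. Its roots [tau] and [- tau^-1] are then
    excluded by [es_merge]. *)
Lemma s_cube : s ^+ 3 = tau ^+ 2.
Proof.
have [D0 aE] := a_formula.
have V0 : V = 0 by rewrite /V (es_cap sys) subrr.
have : delta * (tau - 1) * (tau + 1) * (s - tau) * (s * tau + 1) * (s ^+ 3 - tau ^+ 2) = 0.
  have -> : delta * (tau - 1) * (tau + 1) * (s - tau) * (s * tau + 1) * (s ^+ 3 - tau ^+ 2)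
     = V * s ^+ 2 * D * tau ^+ 2.
    rewrite /V !solved aE /D.
    by field; rewrite two0 tau0 taup1 s0 D0.
  by rewrite V0 !mul0r.
move/eqP; rewrite !mulf_eq0 (negPf delta0) (negPf taum1) (negPf taup1) /= -orbA.
have Z0 : Z = 0 by rewrite /Z (es_merge sys) subrr.
case/or3P; last by rewrite subr_eq0 => /eqP.
(* At [s = tau] the defect [Z] is a nonzero multiple of the expression in [td]. *)
- rewrite subr_eq0 => /eqP sE; exfalso.
  have d1 : delta - 1 != 0.
    apply: contraNneq D0 => /eqP; rewrite subr_eq0 /D sE => /eqP ->; apply/eqP; ring.
  have D'0 : (1 + tau * delta) * tau - tau ^+ 2 - tau * delta != 0 by rewrite -{2}sE.
  have : ((tau - 1) * (tau + 1)) ^+ 2 * (tau * delta + tau ^+ 2 - tau + 1) = 0.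
    have -> : ((tau - 1) * (tau + 1)) ^+ 2 * (tau * delta + tau ^+ 2 - tau + 1) =
        Z * tau ^+ 3 * (delta - 1).
      rewrite /Z !solved aE /D sE.
      by field; rewrite two0 tau0 taup1 D'0.
    by rewrite Z0 !mul0r.
  by apply/eqP; rewrite !mulf_neq0 // expf_neq0 // mulf_neq0.
(* At [s = - tau^-1] the formula for [a] gives 0, and [Z] becomes a nonzero multiple of the
   expression in [tau5]. *)
- rewrite addr_eq0 => /eqP sE; exfalso.
  have {}sE : s = - tau^-1 by rewrite -[s](mulfK tau0) sE mulN1r.
  have a0 : a = 0 by rewrite aE sE addNr mulr0 mul0r.
  have : ((tau - 1) * (tau + 1)) ^+ 2 * (tau ^+ 4 - tau ^+ 3 + tau ^+ 2 - tau + 1) = 0.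
    have -> : ((tau - 1) * (tau + 1)) ^+ 2 * (tau ^+ 4 - tau ^+ 3 + tau ^+ 2 - tau + 1) =
        - Z * tau ^+ 4.
      rewrite /Z !solved a0 sE.
      by field; rewrite ?oppr_eq0 ?oner_eq0 two0 tau0 taup1.
    by rewrite Z0 oppr0 mul0r.
  by apply/eqP; rewrite !mulf_neq0 // expf_neq0 // mulf_neq0.
Qed.
End EigenSystem.

(** The quartic for sigma_+ has leading coefficient [1 + tau^-1] and constant term [1 + tau]. Its
    roots have product [tau], whence the fourth root is [tau / f3]. *)
Lemma eigen_system_of_skein (F : fieldType) (tau beta delta phi a c f1 f2 f3 w x y t : F) :
  beta = tau ^+ 2 -> tau != 0 -> f3 != 0 -> c != 0 ->
  beta - beta^-1 = a * (1 - delta) + c * phi ->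
  t = (tau - tau^-1 - a) / c + phi ->
  [/\ (1 + tau^-1) * (f1 - a) + (1 + tau) / f3 = a + c * t,
      (1 + tau^-1) * f3 + (1 + tau) * (f2 / f3 + a) = - (a + c * t),
      (1 + tau^-1) * (- f2 - 1) - (1 + tau) * (1 + f1 / f3) =
        a * (c * phi) - a * (a + c * t)
    & [/\ c ^+ 2 * w - a * (c * y) = - f2 - 2 - f1 / f3 + a ^+ 2,
          c ^+ 2 * x + c * y = f1 + f3^-1 - 2 * a
        & c ^+ 2 * x - c * y = f3 + f2 / f3 + 2 * a]] ->
  phi ^+ 2 = w * (1 + delta) + x * (beta + beta^-1) + y * phi /\
  t ^+ 2 = w + x * (tau + tau^-1) + y * (t + phi) ->
  eigen_system tau delta a (tau / f3) f1 f2 (c * phi) (c * t)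
    (c ^+ 2 * w) (c ^+ 2 * x) (c * y).
Proof.
move=> b2 t0 f30 c0 sU tE [e3 e1 e2 [s1 sp' sm']] [cE mE].
have q1 : tau / f3 / tau = f3^-1 by rewrite mulrAC mulfV // mul1r.
have q2 : tau / (tau / f3) = f3 by rewrite invfM invrK mulrA mulfV // mul1r.
split; rewrite ?q1 ?q2 // -?b2.
- by rewrite sU; ring.
- by rewrite tE mulrDr [c * (_ / c)]mulrC divfK //; ring.
- by rewrite exprMn cE; ring.
- by rewrite exprMn mE; ring.
Qed.

(* Here v stands for q^2. *)
Section Values.
Variables (F : fieldType) (v : F).
Hypotheses (two0 : 2 != 0 :> F) (v0 : v != 0).
Hypothesis vX : forall n, v ^+ n.+1 != 1.

Let tau := v ^+ 6.
Let delta := (v ^+ 4 + 1) * (v ^+ 9 + 1) * (v ^+ 13 - 1) / (v ^+ 11 * (v - 1) * (v ^+ 3 + 1)).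
Let phi := (v ^+ 7 - 1) * (v ^+ 4 - v ^+ 2 + 1) / (v ^+ 5 * (v - 1)).

Lemma vX_sub1_neq0 n : v ^+ n.+1 - 1 != 0. Proof. by rewrite subr_eq0. Qed.
Lemma vX_add1_neq0 n : v ^+ n.+1 + 1 != 0.
Proof.
apply: contra_neq (vX (n.+1 * 2).-1) => E; rewrite -[_.-1.+1]/(n.+1 * 2)%N exprM.
by rewrite -[v ^+ _](addrK 1) E sub0r sqrrN expr1n.
Qed.
Lemma factor_neq0 (x y z : F) : x * y = z -> z != 0 -> x != 0.
Proof. by move=> <-; rewrite mulf_eq0 negb_or => /andP[]. Qed.

Let vm1_1 : v - 1 != 0. Proof. exact: (vX_sub1_neq0 0). Qed.
Let v3 : v ^+ 2 + v + 1 != 0.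
Proof. by apply: (@factor_neq0 _ (v - 1) _ _ (vX_sub1_neq0 2)); ring. Qed.

Let v12 : v ^+ 4 - v ^+ 2 + 1 != 0.
Proof. by apply: (@factor_neq0 _ (v ^+ 2 + 1) _ _ (vX_add1_neq0 5)); ring. Qed.

Let tau0 : tau != 0. Proof. exact: expf_neq0. Qed.
Let delta0 : delta != 0.
Proof. by rewrite /delta !(mulf_neq0, invr_neq0, expf_neq0, vX_add1_neq0, vX_sub1_neq0). Qed.

Let tau5 : tau ^+ 4 - tau ^+ 3 + tau ^+ 2 - tau + 1 != 0.
Proof. by apply: (@factor_neq0 _ (tau + 1) _ _ (vX_add1_neq0 29)); rewrite /tau; ring. Qed.

(** Up to a power of [v] this is a product of the cyclotomic polynomials of orders 3, 9, 10 and 20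
    at [v], which is no root of unity. *)
Lemma twist_loop_neq0 : tau * delta + tau ^+ 2 - tau + 1 != 0.
Proof.
have -> : tau * delta + tau ^+ 2 - tau + 1 = (v ^+ 2 + v + 1) ^+ 2 * (v ^+ 6 + v ^+ 3 + 1)
  * (v ^+ 4 - v ^+ 3 + v ^+ 2 - v + 1) * (v ^+ 8 - v ^+ 6 + v ^+ 4 - v ^+ 2 + 1) / v ^+ 5.
  by rewrite /tau /delta; field; rewrite v0 vm1_1 (vX_add1_neq0 2).
have v9 : v ^+ 6 + v ^+ 3 + 1 != 0.
  by apply: (@factor_neq0 _ (v ^+ 3 - 1) _ _ (vX_sub1_neq0 8)); ring.
have v10 : v ^+ 4 - v ^+ 3 + v ^+ 2 - v + 1 != 0.
  by apply: (@factor_neq0 _ (v + 1) _ _ (vX_add1_neq0 4)); ring.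
have v20 : v ^+ 8 - v ^+ 6 + v ^+ 4 - v ^+ 2 + 1 != 0.
  by apply: (@factor_neq0 _ (v ^+ 2 + 1) _ _ (vX_add1_neq0 9)); ring.
by rewrite !mulf_neq0 ?invr_neq0 ?expf_neq0.
Qed.

Lemma sub_inv_neq0 : tau - tau^-1 != 0.
Proof.
have -> : tau - tau^-1 = (v ^+ 12 - 1) / v ^+ 6 by rewrite /tau; field.
by rewrite mulf_neq0 ?invr_neq0 ?expf_neq0 // vX_sub1_neq0.
Qed.

Section Solve.
Variables (a s f1 f2 c t w x y : F).
Hypothesis cube_root : forall u : F, u ^+ 3 = v ^+ 12 -> u = v ^+ 4.
Hypotheses (s0 : s != 0) (c0 : c != 0).
Hypothesis sys : eigen_system tau delta a s f1 f2 (c * phi) (c * t)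
  (c ^+ 2 * w) (c ^+ 2 * x) (c * y).

Let phi0 : phi != 0.
Proof. by rewrite /phi !(mulf_neq0, invr_neq0, expf_neq0, vX_sub1_neq0, v12). Qed.

Lemma s_value : s = v ^+ 4.
Proof.
apply: cube_root.
rewrite (s_cube sys two0 tau0 s0 (vX_add1_neq0 5) (vX_sub1_neq0 5) delta0 _
  twist_loop_neq0 tau5).
  by rewrite /tau; ring.
exact: mulf_neq0.
Qed.

(** Both skein coefficients [a] and [c] turn out to have this value. *)
Let u : F := - (v ^+ 4 - 1) / (v * (v ^+ 2 + v + 1)).

Lemma a_value : a = u.
Proof.
have := quartic_factors sys tau0 s0 (vX_add1_neq0 5); rewrite s_value => /eqP.
rewrite mulf_eq0 (negPf (vX_add1_neq0 3)) /= subr_eq0 -mulrA.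
(* This is [s * D] at [s = v ^+ 4]; its factors are nonzero, so [quartic_factors] determines [a]. *)
have -> : v ^+ 4 * ((1 + tau * delta) * v ^+ 4 - tau ^+ 2 - tau * delta) =
    (v ^+ 6 + 1) * (v ^+ 8 - 1) * (v ^+ 10 + 1) * (v ^+ 2 + v + 1) / v.
  by rewrite /tau /delta; field; rewrite v0 vm1_1 (vX_add1_neq0 2).
set R := (X in a * X) => /eqP E.
have R0 : R != 0 by rewrite /R !mulf_neq0 ?invr_neq0 ?vX_add1_neq0 ?vX_sub1_neq0.
apply: (mulIf R0); rewrite E /R /u /tau.
by field; rewrite v0 v3.
Qed.

Lemma c_value : c = u.
Proof.
apply: (mulIf phi0); rewrite (es_Phi sys) a_value /u /phi /tau /delta.
by field; rewrite v0 v3 vm1_1 (vX_add1_neq0 2).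
Qed.

Lemma t_value : t = - ((v ^+ 6 + v ^+ 3 + 1) / v ^+ 3).
Proof.
apply: (mulfI c0); rewrite (es_Theta sys) a_value c_value /u /phi /tau.
by field; rewrite v0 v3 vm1_1.
Qed.

Lemma f1_value : f1 = - v ^+ 3 - 1 + v^-1.
Proof.
rewrite (f1_formula sys tau0 (vX_add1_neq0 5)) (es_Theta sys).
rewrite s_value c_value a_value /u /phi /tau.
by field; rewrite v0 v3 vm1_1 (vX_add1_neq0 5).
Qed.

Lemma f2_value : f2 = v ^+ 3 - v ^+ 2 - v^-1.
Proof.
rewrite (f2_formula sys tau0 s0 (vX_add1_neq0 5)) (es_Theta sys).
rewrite s_value c_value a_value /u /phi /tau.
by field; rewrite v0 v3 vm1_1 (vX_add1_neq0 5).
Qed.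

Let sq_neq0 : v ^+ 2 + 1 != 0. Proof. exact: (vX_add1_neq0 1). Qed.

(** These are the coefficients of 1, U, sigma_+, H and N in S after sigma_- is eliminated by the
    skein relation. *)
Lemma square_values : [/\
   w - x * a = (v ^+ 5 + v ^+ 4 + v ^+ 3 + v ^+ 2 + 1) / (v ^+ 2 * (v ^+ 2 + 1) ^+ 2),
   w + x * a = v * (v ^+ 5 + v ^+ 3 + v ^+ 2 + v + 1) / (v ^+ 2 + 1) ^+ 2,
   x *+ 2 = - ((v ^+ 2 + v + 1) * (v ^+ 4 + v ^+ 2 + 1) / (v * (v ^+ 2 + 1) ^+ 2)),
   y - x * c = (v ^+ 5 + 2 * v ^+ 3 + v + 1) / (v ^+ 4 + v ^+ 2)
 & y + x * c = (v ^+ 5 + v ^+ 4 + 2 * v ^+ 2 + 1) / (v ^+ 3 + v)].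
Proof.
have xE : c ^+ 2 * x = - (v ^+ 2 - v + 1) * (v ^+ 2 - 1) ^+ 2 / (2 * v ^+ 3).
  rewrite (X_formula sys two0 tau0 s0) f1_value f2_value s_value /tau.
  by field; rewrite v0 two0.
have xE' : x = - (v ^+ 2 + v + 1) * (v ^+ 4 + v ^+ 2 + 1) / (2 * v * (v ^+ 2 + 1) ^+ 2).
  apply: (mulfI (expf_neq0 2 c0)); rewrite xE c_value /u.
  by field; rewrite v0 two0 v3 sq_neq0.
have yE : y = (v ^+ 6 + 2 * v ^+ 5 + 4 * v ^+ 3 + 2 * v + 1) / (2 * v ^+ 2 * (v ^+ 2 + 1)).
  apply: (mulfI c0); rewrite (Y_formula sys two0 tau0 s0) f1_value f2_value s_value.
  by rewrite a_value c_value /u /tau; field; rewrite v0 two0 v3 sq_neq0.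
have wE : w = (v ^+ 8 + v ^+ 6 + 2 * v ^+ 5 + 2 * v ^+ 4 + 2 * v ^+ 3 + v ^+ 2 + 1)
    / (2 * v ^+ 2 * (v ^+ 2 + 1) ^+ 2).
  apply: (mulfI (expf_neq0 2 c0)); rewrite (W_formula sys) f1_value f2_value s_value a_value yE.
  by rewrite c_value /u /tau; field; rewrite v0 two0 v3 sq_neq0.
have qd : v ^+ 4 + v ^+ 2 != 0.
  by have := mulf_neq0 (expf_neq0 2 v0) sq_neq0; rewrite mulrDr mulr1 -exprD.
have cd : v ^+ 3 + v != 0.
  by have := mulf_neq0 v0 sq_neq0; rewrite mulrDr mulr1 -exprS.
rewrite yE wE xE' a_value c_value /u.
by split; field; rewrite ?v0 ?two0 ?v3 ?sq_neq0 ?qd ?cd.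
Qed.

End Solve.
End Values.

(** * Quantum integers as rational functions of v = q^2 *)

Section QIntegers.
Variables (F : fieldType) (r : F).
Hypotheses (r0 : r != 0) (rX : forall n, r ^+ n.+1 != 1).
Let v := r ^+ 2.
Definition qnum (n : nat) : F := (r ^+ n - r ^- n) / (r - r^-1).

Lemma sqX_sub1_neq0 n : v ^+ n.+1 - 1 != 0.
Proof. by rewrite /v -exprM subr_eq0 mul2n doubleS. Qed.

Lemma qnumE n : qnum n.+1 = (v ^+ n.+1 - 1) / (r ^+ n * (v - 1)).
Proof.
have a : v ^+ n.+1 - 1 = (r ^+ n.+1 - r ^- n.+1) * r ^+ n.+1.
  by rewrite mulrBl mulVf ?expf_neq0 // -expr2 -!exprM mulnC.
have b : v - 1 = (r - r^-1) * r by rewrite mulrBl mulVf // -expr2.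
have b0 : r - r^-1 != 0.
  by have := sqX_sub1_neq0 0; rewrite expr1 b mulf_eq0 negb_or => /andP[].
rewrite a b /qnum; move: (_ - r ^- n.+1) (r - r^-1) b0 => A B b0; rewrite exprSr.
by move: (r ^+ n) (expf_neq0 n r0) => R R0; field; rewrite r0 b0 R0.
Qed.

Lemma sq_sub1_neq0 : v - 1 != 0. Proof. exact: (sqX_sub1_neq0 0). Qed.

Lemma delta_v : (qnum 3 * qnum 8 * qnum 13 * qnum 18) / (qnum 4 * qnum 6 * qnum 9) =
  (v ^+ 4 + 1) * (v ^+ 9 + 1) * (v ^+ 13 - 1) / (v ^+ 11 * (v - 1) * (v ^+ 3 + 1)).
Proof.
have p3 : v ^+ 3 + 1 != 0.
  have := sqX_sub1_neq0 5; have -> : v ^+ 6 - 1 = (v ^+ 3 - 1) * (v ^+ 3 + 1) by ring.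
  by rewrite mulf_eq0 negb_or => /andP[].
rewrite !qnumE.
have -> : v ^+ 8 - 1 = (v ^+ 4 - 1) * (v ^+ 4 + 1) by ring.
have -> : v ^+ 18 - 1 = (v ^+ 9 - 1) * (v ^+ 9 + 1) by ring.
have -> : v ^+ 6 - 1 = (v ^+ 3 - 1) * (v ^+ 3 + 1) by ring.
have := sqX_sub1_neq0 2; have := sqX_sub1_neq0 3; have := sqX_sub1_neq0 8.
have := sq_sub1_neq0; move: p3.
(* The denominators of [qnumE] contribute r to the power (2 + 7 + 12 + 17) - (3 + 5 + 8) = 22. The
   cyclotomic-type factors are then made opaque, so that [field] only cancels atoms. *)
have -> : v ^+ 11 = r ^+ 22 by rewrite /v -exprM.
move: (v ^+ 3 - 1) (v ^+ 3 + 1) (v ^+ 9 - 1) (v ^+ 4 - 1) (v - 1) => A B D E G *.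
by field; rewrite r0; do !(apply/andP; split).
Qed.

Lemma phi_v : (qnum 2 * qnum 7 * qnum 12) / (qnum 4 * qnum 6) =
  (v ^+ 7 - 1) * (v ^+ 4 - v ^+ 2 + 1) / (v ^+ 5 * (v - 1)).
Proof.
rewrite !qnumE.
have -> : v ^+ 12 - 1 = (v ^+ 6 - 1) * (v ^+ 2 + 1) * (v ^+ 4 - v ^+ 2 + 1) by ring.
have := sqX_sub1_neq0 3; have -> : v ^+ 4 - 1 = (v ^+ 2 - 1) * (v ^+ 2 + 1) by ring.
rewrite mulf_eq0 negb_or => /andP[]; have := sqX_sub1_neq0 5; have := sq_sub1_neq0.
have -> : v ^+ 5 = r ^+ 10 by rewrite /v -exprM.
move: (v ^+ 6 - 1) (v ^+ 2 - 1) (v ^+ 2 + 1) (v - 1) => A B D E *.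
by field; rewrite r0; do !(apply/andP; split).
Qed.

Lemma qnum_triangle : qnum 9 / qnum 3 = (v ^+ 6 + v ^+ 3 + 1) / v ^+ 3.
Proof.
rewrite !qnumE.
have -> : v ^+ 9 - 1 = (v ^+ 3 - 1) * (v ^+ 6 + v ^+ 3 + 1) by ring.
have := sqX_sub1_neq0 2; have := sq_sub1_neq0.
have -> : (v ^+ 6 + v ^+ 3 + 1) / v ^+ 3 = (v ^+ 6 + v ^+ 3 + 1) / r ^+ 6.
  by congr (_ / _); rewrite /v -exprM.
move: (v ^+ 3 - 1) (v ^+ 6 + v ^+ 3 + 1) (v - 1) => A K E e h.
by field; rewrite r0 e h.
Qed.

Lemma qnum_crossing_coef : (qnum 2 * qnum 3 * qnum 6) / qnum 4 ^+ 2 =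
  (v ^+ 2 + v + 1) * (v ^+ 4 + v ^+ 2 + 1) / (v * (v ^+ 2 + 1) ^+ 2).
Proof.
rewrite !qnumE.
have := sqX_sub1_neq0 3; have -> : v ^+ 4 - 1 = (v ^+ 2 - 1) * (v ^+ 2 + 1) by ring.
rewrite mulf_eq0 negb_or => /andP[h1 h2].
have -> : v ^+ 6 - 1 = (v ^+ 2 - 1) * (v ^+ 4 + v ^+ 2 + 1) by ring.
have -> : v ^+ 3 - 1 = (v - 1) * (v ^+ 2 + v + 1) by ring.
have h3 := sq_sub1_neq0; move: h1 h2 h3.
have -> : v * (v ^+ 2 + 1) ^+ 2 = r ^+ 2 * (v ^+ 2 + 1) ^+ 2 by [].
move: (v ^+ 2 - 1) (v ^+ 2 + 1) (v - 1) (v ^+ 2 + v + 1) (v ^+ 4 + v ^+ 2 + 1) => A B D E G *.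
by field; rewrite r0; do !(apply/andP; split).
Qed.
End QIntegers.

(** * Arithmetic of the field Q(q) *)

Section FractionField.
Import FracField.
Local Open Scope quotient_scope.

Lemma fraction_repr (R : idomainType) (x : {fraction R}) :
  exists n d : R, d != 0 /\ x * tofrac d = tofrac n.
Proof.
elim/quotW: x => x; exists \n_x, \d_x; split; first exact: denom_ratioP.
unlock tofrac; rewrite -[LHS]pi_mul; apply/eqmodP.
rewrite /= equivfE /mulf !numden_Ratio ?(oner_neq0, mulf_neq0, denom_ratioP) //.
by rewrite !mulr1 mulrC.
Qed.

End FractionField.

(** After clearing denominators, the leading coefficients would give a rational square equal to a
    negative number. *)
Lemma sqr_neq_opp3 (z : Qq) : z ^+ 2 != - 3.
Proof.
have [n [d [d0 zd]]] := fraction_repr z; apply/eqP=> z3.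
have /eqP : tofrac (n ^+ 2) = tofrac (- 3 * d ^+ 2) :> Qq.
  rewrite [RHS]tofracM tofracN rmorph_nat (tofracXn 2 n) (tofracXn 2 d).
  by rewrite -zd exprMn z3.
rewrite tofrac_eq => /eqP E.
have : lead_coef n ^+ 2 = - 3 * lead_coef d ^+ 2.
  have -> : lead_coef n ^+ 2 = lead_coef (n ^+ 2) by rewrite lead_coef_exp.
  rewrite E lead_coefM lead_coef_exp; congr (_ * _).
  by rewrite lead_coefN -[3]/(3%:R) -polyC_natr lead_coefC.
have ld : 0 < lead_coef d ^+ 2 by rewrite exprn_even_gt0 //= lead_coef_eq0.
move=> E2; have := sqr_ge0 (lead_coef n); rewrite E2 mulNr oppr_ge0 leNgt.
by rewrite mulr_gt0.
Qed.

Lemma Qq_two_neq0 : 2 != 0 :> Qq.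
Proof.
have -> : 2 = tofrac 2%:R :> Qq by rewrite rmorph_nat.
by rewrite tofrac_eq0 -polyC_natr polyC_eq0.
Qed.

Lemma q_neq0 : q != 0.
Proof. by rewrite /q tofrac_eq0 polyX_eq0. Qed.

Lemma qX_neq1 n : q ^+ n.+1 != 1.
Proof.
rewrite /q -tofracXn -tofrac1 tofrac_eq.
apply/eqP => /(congr1 (fun p : {poly rat} => size p)).
by rewrite size_polyXn size_poly1.
Qed.

(** Otherwise [u ^+ 2 + u * w + w ^+ 2] vanishes, and completing the square makes [(2 * u + w) / w]
    a square root of -3. *)
Lemma cube_inj (F : fieldType) (u w : F) : (forall z : F, z ^+ 2 != - 3) -> w != 0 ->
  u ^+ 3 = w ^+ 3 -> u = w.
Proof.
move=> N3 w0 /eqP; rewrite -subr_eq0.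
have -> : u ^+ 3 - w ^+ 3 = (u - w) * (u ^+ 2 + u * w + w ^+ 2) by ring.
rewrite mulf_eq0 subr_eq0 => /orP[/eqP //|/eqP E].
case/eqP: (N3 ((2 * u + w) / w)).
have -> : ((2 * u + w) / w) ^+ 2 = (4 * (u ^+ 2 + u * w + w ^+ 2) - 3 * w ^+ 2) / w ^+ 2.
  by field.
by rewrite E; field.
Qed.

(** * Coordinates and linear functionals *)

Lemma basis_coords (V : lmodType Qq) n (b : n.-tuple V) : is_basis b ->
  exists f : V -> 'rV[Qq]_n,
    [/\ forall k u v, f (k *: u + v) = k *: f u + f v,
        forall v, v = \sum_(i < n) f v 0 i *: tnth b i
      & forall i, f (tnth b i) = delta_mx 0 i].
Proof.
move=> hb; pose f v := projT1 (cid (hb v)).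
have fE v : v = \sum_(i < n) f v 0 i *: tnth b i by case: (projT2 (cid (hb v))).
have fU v (c : 'rV_n) : v = \sum_(i < n) c 0 i *: tnth b i -> f v = c.
  by case: (projT2 (cid (hb v))) => _; apply.
exists f; split=> // [k u v|i].
  apply: fU; rewrite {1}[u]fE {1}[v]fE scaler_sumr -big_split /=.
  by apply: eq_bigr => i _; rewrite !mxE scalerDl scalerA.
apply: fU; rewrite (bigD1 i) //= mxE !eqxx scale1r big1 ?addr0 // => j ji.
by rewrite mxE (negPf ji) andbF scale0r.
Qed.

(** Abstract form of the triangle computation: [v] is the vertex, [w] its composite with H, and [k],
    [l], [p] are the scalars of the two twists and of the bubble. *)
Lemma skein_solve (F : fieldType) (V : lmodType F) (v w : V) (k l a c p : F) :
  c != 0 -> k *: v - l *: v = a *: v + c *: (w - p *: v) ->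
  w = ((k - l - a) / c + p) *: v.
Proof.
move=> c0 E; apply: (scalerI c0).
have -> : c *: w = k *: v - l *: v - a *: v + (c * p) *: v.
  by rewrite E scalerBr scalerA (addrC (a *: v)) addrK subrK.
by rewrite scalerA mulrDr mulrCA mulfV // mulr1 -!scalerBl -scalerDl.
Qed.

Lemma half_sum (R : pzRingType) (V : lmodType R) (k : R) (u v : V) : k + k = 1 ->
  u = k *: (u + v + (u - v)).
Proof. by move=> k2; rewrite addrACA subrr addr0 scalerDr -scalerDl k2 scale1r. Qed.

Definition functional (V : lmodType Qq) (l : V -> Qq) :=
  forall k u v, l (k *: u + v) = k * l u + l v.

Section Functional.
Variables (V : lmodType Qq) (l : V -> Qq).
Hypothesis l_lin : functional l.

Lemma functional0 : l 0 = 0.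
Proof. by have := l_lin (-1) 0 0; rewrite scaler0 addr0 mulN1r addNr. Qed.
Lemma functionalD u v : l (u + v) = l u + l v.
Proof. by have := l_lin 1 u v; rewrite scale1r mul1r. Qed.
Lemma functionalZ k u : l (k *: u) = k * l u.
Proof. by have := l_lin k u 0; rewrite functional0 !addr0. Qed.
Lemma functionalN u : l (- u) = - l u.
Proof. by rewrite -scaleN1r functionalZ mulN1r. Qed.
Definition functionalE := (functionalD, functionalN, functionalZ).
End Functional.

Lemma skein_degenerate (F : fieldType) (k d a : F) : k != 0 -> k - k^-1 != 0 ->
  k - k^-1 - a = 0 -> k ^+ 2 - (k ^+ 2)^-1 = a * (1 - d) ->
  k * d + k ^+ 2 - k + 1 = 0.
Proof.
move=> k0 g0 /eqP; rewrite subr_eq0 => /eqP <- E; apply: (mulfI g0).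
transitivity (k * (k ^+ 2 - (k ^+ 2)^-1 - (k - k^-1) * (1 - d))); first by field.
by rewrite E subrr !mulr0.
Qed.

(** * The algebra End(I^2) *)

Section Algebra.
Variables (C : moncat) (tau beta delta phi : Qq).
Variables (cup : C 0%N 2%N) (cap : C 2%N 0%N) (m : C 2%N 1%N) (s : C 1%N 2%N).
Variables (sp sm : C 2%N 2%N).
Hypothesis zigl : (cap ⊗ mid 1) ∘ (mid 1 ⊗ cup) = mid 1 :> C 1%N 1%N.
Hypothesis zigr : (mid 1 ⊗ cap) ∘ (cup ⊗ mid 1) = mid 1 :> C 1%N 1%N.
Hypothesis sEr : s = (mid 1 ⊗ m) ∘ (cup ⊗ mid 1).
Hypothesis sEl : s = (m ⊗ mid 1) ∘ (mid 1 ⊗ cup).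
Hypothesis slidem : (mid 1 ⊗ cap) ∘ (sm ⊗ mid 1) = (cap ⊗ mid 1) ∘ (mid 1 ⊗ sp).
Hypothesis slidep : (mid 1 ⊗ cap) ∘ (sp ⊗ mid 1) = (cap ⊗ mid 1) ∘ (mid 1 ⊗ sm).
Hypothesis smsp : sm ∘ sp = mid 2.
Hypothesis spsm : sp ∘ sm = mid 2.
Hypothesis push : (mid 1 ⊗ sp) ∘ (sp ⊗ mid 1) ∘ (mid 1 ⊗ s) = (s ⊗ mid 1) ∘ sp.
Hypothesis cap_sp : cap ∘ sp = beta *: cap.
Hypothesis m_sp : m ∘ sp = tau *: m.
Hypothesis m_s : m ∘ s = phi *: mid 1.
Hypothesis cap_cup : cap ∘ cup = delta *: mid 0.
Hypothesis m_cup : m ∘ cup = 0.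
Hypotheses (two0 : 2 != 0 :> Qq) (tau0 : tau != 0) (beta0 : beta != 0).

Variables U H N P : C 2%N 2%N.
Hypotheses (UE : U = cup ∘ cap) (HE : H = (m ⊗ mid 1) ∘ (mid 1 ⊗ s)).
Hypotheses (NE : N = s ∘ m) (PE : P = sp + sm).
Hypothesis hb : is_basis [tuple mid 2; U; H; N; P].

Lemma coordinates : exists x : nat -> C 2%N 2%N -> Qq,
  [/\ forall i, functional (x i),
      forall v, v = x 0%N v *: mid 2 + x 1%N v *: U + x 2%N v *: H
        + x 3%N v *: N + x 4%N v *: P
    & forall i, (i < 5)%N ->
      [/\ x i (mid 2) = (i == 0)%N%:R, x i U = (i == 1)%N%:R, x i H = (i == 2)%N%:R,
          x i N = (i == 3)%N%:R & x i P = (i == 4)%N%:R]].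
Proof.
have [f [fD fE fb]] := basis_coords hb.
(* Indexing by [nat] uses the default of [inord], which sends indices from 5 on to 0; these still
   give functionals, but the duality is claimed only below 5. *)
exists (fun i v => f v 0 (inord i)); split=> [i k u v|v|i i5].
- by rewrite fD !mxE.
- rewrite {1}[v]fE !big_ord_recr big_ord0 /= add0r.
  by congr (_ + _ + _ + _ + _); congr (_ *: _); congr (f v 0 _); apply: val_inj;
    rewrite /= inordK.
have xb (j : 'I_5) : f (tnth [tuple mid 2; U; H; N; P] j) 0 (inord i) = (i == j)%:R.
  by rewrite fb mxE eqxx -val_eqE /= inordK.
by split; [exact: (xb 0)|exact: (xb 1)|exact: (xb 2)|exact: (xb 3)|exact: (xb 4)].
Qed.

Lemma m_sm : m ∘ sm = tau^-1 *: m.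
Proof.
rewrite -[in RHS](compf1 m) -spsm mcompA m_sp compZl scalerA (mulVf tau0).
by rewrite scale1r.
Qed.

Lemma cap_sm : cap ∘ sm = beta^-1 *: cap.
Proof.
rewrite -[in RHS](compf1 cap) -spsm mcompA cap_sp compZl scalerA (mulVf beta0).
by rewrite scale1r.
Qed.

Local Notation turn := (turn cup cap).

Lemma turn_sp : turn sp = sm. Proof. exact: turn_slide. Qed.
Lemma turn_sm : turn sm = sp. Proof. exact: turn_slide. Qed.
Lemma turn_id : turn (mid 2) = U. Proof. by rewrite UE turn1. Qed.
Lemma turn_U : turn U = mid 2. Proof. by rewrite UE turnU. Qed.
Lemma turn_H : turn H = N. Proof. by rewrite NE (turnH zigr sEr sEl HE). Qed.
Lemma turn_N : turn N = H. Proof. by rewrite NE (turnN zigr sEr sEl HE). Qed.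
Lemma turn_P : turn P = P. Proof. by rewrite PE turnD turn_sp turn_sm addrC. Qed.

Definition turn_basis := (turn_id, turn_U, turn_H, turn_N, turn_P).

Lemma turn_turn f : turn (turn f) = f.
Proof.
have [x [_ xE _]] := coordinates.
by rewrite [f]xE !(turnD, turnZ, turn_basis).
Qed.

Lemma End2_comm (f g : C 2%N 2%N) : f ∘ g = g ∘ f.
Proof. by rewrite -[f ∘ g]turn_turn turn_turn_comp // !turn_turn. Qed.

Lemma skein : exists a c, sp - sm = a *: (mid 2 - U) + c *: (H - N).
Proof.
have [x [xl xE xb]] := coordinates; set D := sp - sm.
have [x01 x0U x0H x0N x0P] := xb 0%N isT.
have [x21 x2U x2H x2N x2P] := xb 2%N isT.
have [x41 x4U x4H x4N x4P] := xb 4%N isT.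
have tD : turn D = - D by rewrite turnD -scaleN1r turnZ scaleN1r turn_sp turn_sm opprB.
have tE : turn D = x 0%N D *: U + x 1%N D *: mid 2 + x 2%N D *: N + x 3%N D *: H
    + x 4%N D *: P.
  by rewrite {1}[D]xE !(turnD, turnZ, turn_basis).
have e1 : x 1%N D = - x 0%N D.
  rewrite -(functionalN (xl 0%N)) -tD tE !(functionalE (xl 0%N)).
  by rewrite x01 x0U x0H x0N x0P !mulr0 mulr1 !addr0 add0r.
have e3 : x 3%N D = - x 2%N D.
  rewrite -(functionalN (xl 2%N)) -tD tE !(functionalE (xl 2%N)).
  by rewrite x21 x2U x2H x2N x2P !mulr0 mulr1 !addr0 add0r.
have e4 : x 4%N D = - x 4%N D.
  rewrite -(functionalN (xl 4%N)) -tD {1}tE !(functionalE (xl 4%N)).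
  by rewrite x41 x4U x4H x4N x4P !mulr0 mulr1 !add0r.
(* The rotation fixes P but negates [D], so this coordinate equals its own opposite. *)
have {}e4 : x 4%N D = 0.
  move/eqP: e4; rewrite -addr_eq0 -mulr2n -mulr_natl mulf_eq0 (negPf two0) => /eqP; exact.
exists (x 0%N D), (x 2%N D).
by rewrite [LHS]xE e1 e3 e4 scale0r addr0 !scaleNr !scalerBr addrA.
Qed.

Lemma U_sp : U ∘ sp = beta *: U. Proof. by rewrite UE -mcompA cap_sp compZr. Qed.
Lemma U_sm : U ∘ sm = beta^-1 *: U. Proof. by rewrite UE -mcompA cap_sm compZr. Qed.
Lemma U_H : U ∘ H = phi *: U.
Proof. by rewrite UE -mcompA (cap_H zigl zigr sEr sEl HE m_s) compZr. Qed.
Lemma U_U : U ∘ U = delta *: U.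
Proof. by rewrite UE -mcompA (mcompA cap) cap_cup compZl comp1f compZr. Qed.
Lemma N_U : N ∘ U = 0.
Proof. by rewrite NE UE -mcompA (mcompA m) m_cup comp0f compf0. Qed.
Lemma N_sp : N ∘ sp = tau *: N. Proof. by rewrite NE -mcompA m_sp compZr. Qed.
Lemma N_sm : N ∘ sm = tau^-1 *: N. Proof. by rewrite NE -mcompA m_sm compZr. Qed.
Lemma N_N : N ∘ N = phi *: N.
Proof. by rewrite NE -mcompA (mcompA m) m_s compZl comp1f compZr. Qed.

(** This is [turn_crossH] for [sp] and [sm]. Its pushing hypothesis is [push] multiplied on both
    sides by inverse crossings, and its scalar is inverse to the twist of [sm]. *)
Lemma turn_spH : turn (sp ∘ H) = tau *: (H ∘ sm).
Proof.
apply: (turn_crossH zigr sEr sEl HE slidep); last first.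
  by rewrite m_sm scalerA (mulfV tau0) scale1r.
have tc n : mid n ⊗ sm ∘ mid n ⊗ sp = mid (n + 2) :> C (n + 2)%N (n + 2)%N.
  by rewrite -tens_compl smsp tens11.
have ct n : sm ⊗ mid n ∘ sp ⊗ mid n = mid (2 + n) :> C (2 + n)%N (2 + n)%N.
  by rewrite -tens_compr smsp tens11.
rewrite -[in RHS](compf1 (s ⊗ mid 1)) -[X in _ ∘ (_ ∘ X)]spsm.
rewrite (mcompA (s ⊗ mid 1)) -push !mcompA -(mcompA (sm ⊗ mid 1) (mid 1 ⊗ sm)).
by rewrite (tc 1%N) compf1 (ct 1%N) comp1f.
Qed.

(** Applying the involution [turn] to [turn_spH] gives this by commutativity. *)
Lemma turn_smH : turn (sm ∘ H) = tau^-1 *: (H ∘ sp).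
Proof.
rewrite (End2_comm H) -[sp ∘ H]turn_turn turn_spH turnZ scalerA (mulVf tau0) scale1r.
by rewrite (End2_comm H).
Qed.

Lemma turn_S : turn (H ∘ H) = H ∘ H.
Proof. exact: (turnS zigr sEr sEl HE). Qed.

(** * Consequences of the skein relation *)

Section Skein.
Variables a c : Qq.
Hypothesis sk : sp - sm = a *: (mid 2 - U) + c *: (H - N).

Lemma skein_U : beta - beta^-1 = a * (1 - delta) + c * phi.
Proof.
have [x [xl _ xb]] := coordinates; have /= [_ xU _ _ _] := xb 1%N isT.
have : U ∘ (sp - sm) = U ∘ (a *: (mid 2 - U) + c *: (H - N)) by rewrite sk.
rewrite compBr compDr !compZr !compBr U_sp U_sm compf1 U_U U_H (End2_comm U N) N_U.
move/(congr1 (x 1%N)); rewrite !(functionalE (xl _)) (functional0 (xl _)) xU => E.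
by rewrite -[LHS]mulr1 mulrBl E; ring.
Qed.

Hypothesis c0 : c != 0.
Definition triangle_value := (tau - tau^-1 - a) / c + phi.
Local Notation t := triangle_value.

Lemma m_H : m ∘ H = t *: m.
Proof.
have : m ∘ (sp - sm) = m ∘ (a *: (mid 2 - U) + c *: (H - N)) by rewrite sk.
rewrite compBr compDr !compZr !compBr m_sp m_sm compf1 UE NE !mcompA m_cup comp0f subr0 m_s.
by rewrite compZl comp1f => /(skein_solve c0).
Qed.

Lemma N_H : N ∘ H = t *: N.
Proof. by rewrite NE -mcompA m_H compZr. Qed.

(* A functional killing U and N factors through A/(U, N). *)
Section Evaluate.
Variable l : C 2%N 2%N -> Qq.
Hypotheses (ll : functional l) (lU : l U = 0) (lN : l N = 0).
Local Notation S := (H ∘ H).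

(** Modulo U and N the skein relation reads c H = sigma_+ - sigma_- - a. This and the next lemmas
    thus reduce words in H to Laurent polynomials in sigma_+. *)
Lemma eval_H : c * l H = l sp - l sm - a * l (mid 2).
Proof.
move: (congr1 l sk); rewrite !(functionalE ll) lU lN => E.
by rewrite E; ring.
Qed.

Lemma eval_Hsp : c * l (H ∘ sp) = l (sp ∘ sp) - l (mid 2) - a * l sp.
Proof.
have := congr1 (fun f => l (f ∘ sp)) sk.
rewrite /= compBl compDl !compZl !compBl comp1f U_sp N_sp smsp !(functionalE ll) lU lN => E.
by rewrite E; ring.
Qed.

Lemma eval_Hsm : c * l (H ∘ sm) = l (mid 2) - l (sm ∘ sm) - a * l sm.
Proof.
have := congr1 (fun f => l (f ∘ sm)) sk.
rewrite /= compBl compDl !compZl !compBl comp1f U_sm N_sm spsm !(functionalE ll) lU lN => E.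
by rewrite E; ring.
Qed.

Lemma skein_H : sp ∘ H - sm ∘ H = a *: (H - phi *: U) + c *: (H ∘ H - t *: N).
Proof. by rewrite -compBl sk compDl !compZl !compBl comp1f U_H N_H. Qed.

Lemma eval_S : c * l S = l (H ∘ sp) - l (H ∘ sm) - a * l H.
Proof.
have := congr1 l skein_H.
rewrite !(functionalE ll) lU lN (End2_comm H sp) (End2_comm H sm) => E.
by rewrite E; ring.
Qed.

(** The rotation of [skein_H]. Since it exchanges U and N with 1 and H, it contributes a second
    equation modulo U and N, the source of the quartic. *)
Lemma eval_turn : tau * l (H ∘ sm) - tau^-1 * l (H ∘ sp) =
  - a * phi * l (mid 2) + c * l S - c * t * l H.
Proof.
have := congr1 (fun f => l (turn f)) skein_H.
rewrite /= -scaleN1r !(turnD, turnZ) -!scaleN1r !turnZ turn_spH turn_smH turn_S !turn_basis.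
rewrite !(functionalE ll) lN => E.
by apply: (etrans _ (etrans E _)); ring.
Qed.
End Evaluate.

Lemma S_coordinates : exists w x y,
  H ∘ H = w *: (mid 2 + U) + x *: P + y *: (H + N).
Proof.
have [x [xl xE xb]] := coordinates.
have /= [x01 x0U x0H x0N x0P] := xb 0%N isT.
have /= [x21 x2U x2H x2N x2P] := xb 2%N isT.
have := turn_S; rewrite {1}[H ∘ H]xE !(turnD, turnZ, turn_basis) => tS.
have e1 : x 1%N (H ∘ H) = x 0%N (H ∘ H).
  rewrite -[in RHS]tS !(functionalE (xl 0%N)) x01 x0U x0H x0N x0P; ring.
have e3 : x 3%N (H ∘ H) = x 2%N (H ∘ H).
  rewrite -[in RHS]tS !(functionalE (xl 2%N)) x21 x2U x2H x2N x2P; ring.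
exists (x 0%N (H ∘ H)), (x 4%N (H ∘ H)), (x 2%N (H ∘ H)).
rewrite [LHS]xE e1 e3 !scalerDr -!addrA; congr (_ + (_ + _)).
by rewrite [RHS]addrC -addrA.
Qed.

(** Composition with U and with N makes every term a multiple of U or of N, whose coefficients are
    then compared. *)
Lemma S_closure w x y : H ∘ H = w *: (mid 2 + U) + x *: P + y *: (H + N) ->
  phi ^+ 2 = w * (1 + delta) + x * (beta + beta^-1) + y * phi /\
  t ^+ 2 = w + x * (tau + tau^-1) + y * (t + phi).
Proof.
move=> SE; have [z [zl _ zb]] := coordinates.
have /= [_ z1U _ _ _] := zb 1%N isT; have /= [_ _ _ z3N _] := zb 3%N isT.
split.
- have := congr1 (fun f => z 1%N (U ∘ f)) SE.
  rewrite /= mcompA U_H compZl U_H !compDr !compZr PE !compDr compf1 U_U U_sp U_sm U_H.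
  rewrite (End2_comm U N) N_U !(functionalE (zl _)) (functional0 (zl _)) z1U => E.
  by rewrite expr2 -[phi * phi]mulr1 -mulrA E; ring.
- have := congr1 (fun f => z 3%N (N ∘ f)) SE.
  rewrite /= mcompA N_H compZl N_H !compDr !compZr PE !compDr compf1 N_U N_sp N_sm N_H N_N.
  rewrite !(functionalE (zl _)) (functional0 (zl _)) z3N => E.
  by rewrite expr2 -[t * t]mulr1 -mulrA E; ring.
Qed.

Lemma dual_functionals : exists l1 lp lm : C 2%N 2%N -> Qq,
  [/\ [/\ functional l1, functional lp & functional lm],
      [/\ l1 (mid 2) = 1, l1 sp = 0, l1 sm = 0, l1 U = 0 & l1 N = 0],
      [/\ lp (mid 2) = 0, lp sp = 1, lp sm = 0, lp U = 0 & lp N = 0]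
    & [/\ lm (mid 2) = 0, lm sp = 0, lm sm = 1, lm U = 0 & lm N = 0]].
Proof.
have [x [xl xE xb]] := coordinates.
have half2 : 2^-1 + 2^-1 = 1 :> Qq.
  by rewrite -[RHS](mulVf two0); ring.
have cc : c^-1 * c = 1 by rewrite mulVf.
have spE : sp = 2^-1 *: (P + (a *: (mid 2 - U) + c *: (H - N))).
  rewrite -sk PE; exact: half_sum half2.
have smE : sm = 2^-1 *: (P - (a *: (mid 2 - U) + c *: (H - N))).
  rewrite -sk PE opprB [sp + _]addrC; exact: half_sum half2.
have /= [x01 x0U x0H x0N x0P] := xb 0%N isT.
have /= [x21 x2U x2H x2N x2P] := xb 2%N isT.
have /= [x41 x4U x4H x4N x4P] := xb 4%N isT.
have xp i : x i sp = 2^-1 * (x i P + (a * (x i (mid 2) - x i U) + c * (x i H - x i N))).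
  by rewrite {1}spE !(functionalE (xl i)).
have xm i : x i sm = 2^-1 * (x i P - (a * (x i (mid 2) - x i U) + c * (x i H - x i N))).
  by rewrite {1}smE !(functionalE (xl i)).
(* Modulo U and N, substitute P = sigma_+ + sigma_- and H = (sigma_+ - sigma_- - a) / c, then
   collect the coefficients of 1, sigma_+ and sigma_-. *)
exists (fun v => x 0%N v - a / c * x 2%N v), (fun v => x 4%N v + x 2%N v / c),
  (fun v => x 4%N v - x 2%N v / c).
split; split.
- by move=> k u v; rewrite !(functionalE (xl _)); ring.
- by move=> k u v; rewrite !(functionalE (xl _)); ring.
- by move=> k u v; rewrite !(functionalE (xl _)); ring.
all: rewrite ?xp ?xm ?x01 ?x0U ?x0H ?x0N ?x0P ?x21 ?x2U ?x2H ?x2N ?x2P.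
all: rewrite ?x41 ?x4U ?x4H ?x4N ?x4P.
- ring.
- by transitivity (2^-1 * a * (1 - c^-1 * c)); [ring|rewrite cc; ring].
- by transitivity (2^-1 * a * (c^-1 * c - 1)); [ring|rewrite cc; ring].
- ring.
- ring.
- ring.
- by transitivity (2^-1 + 2^-1 * (c^-1 * c)); [ring|rewrite cc mulr1].
- by transitivity (2^-1 * (1 - c^-1 * c)); [ring|rewrite cc; ring].
- ring.
- ring.
- ring.
- by transitivity (2^-1 * (1 - c^-1 * c)); [ring|rewrite cc; ring].
- by transitivity (2^-1 + 2^-1 * (c^-1 * c)); [ring|rewrite cc mulr1].
- ring.
- ring.
Qed.

(** In the basis 1, sigma_+, sigma_- of A/(U, N), the coordinates of the square of sigma_+ are
    [- f2], [f1], [f3], because sigma_+ is a root of X^3 - f1 X^2 + f2 X - f3. The equations are the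
    coordinates of [eval_turn] and of the two expressions for S. *)
Lemma scalar_system w x y : H ∘ H = w *: (mid 2 + U) + x *: P + y *: (H + N) ->
  exists f1 f2 f3 : Qq, f3 != 0 /\
  [/\ (1 + tau^-1) * (f1 - a) + (1 + tau) / f3 = a + c * t,
      (1 + tau^-1) * f3 + (1 + tau) * (f2 / f3 + a) = - (a + c * t),
      (1 + tau^-1) * (- f2 - 1) - (1 + tau) * (1 + f1 / f3) =
        a * (c * phi) - a * (a + c * t)
    & [/\ c ^+ 2 * w - a * (c * y) = - f2 - 2 - f1 / f3 + a ^+ 2,
          c ^+ 2 * x + c * y = f1 + f3^-1 - 2 * a
        & c ^+ 2 * x - c * y = f3 + f2 / f3 + 2 * a]].
Proof.
move=> SE; have [z [_ zE _]] := coordinates.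
have [z0 [z1 [z2 [z3 [z4 AE]]]]] : exists z0 z1 z2 z3 z4, sp ∘ sp =
    z0 *: mid 2 + z1 *: U + z2 *: H + z3 *: N + z4 *: P by eexists _, _, _, _, _; apply: zE.
(* Multiplying [AE] by [sm] relates the square of [sm] to that of [sp]. *)
have BE : sp = z0 *: sm + z1 *: (beta^-1 *: U) + z2 *: (H ∘ sm)
    + z3 *: (tau^-1 *: N) + z4 *: (mid 2 + sm ∘ sm).
  have := congr1 (fun f => f ∘ sm) AE.
  rewrite /= !compDl !compZl comp1f U_sm N_sm PE compDl spsm -mcompA spsm compf1; exact.
have evS l (ll : functional l) (lU : l U = 0) (lN : l N = 0) :
    c ^+ 2 * (w * l (mid 2) + x * (l sp + l sm)) + c * y * (c * l H) =
    l (sp ∘ sp) - l (mid 2) - a * l sp - (l (mid 2) - l (sm ∘ sm) - a * l sm)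
     - a * (c * l H).
  have -> : c ^+ 2 * (w * l (mid 2) + x * (l sp + l sm)) + c * y * (c * l H) =
      c * (c * l (H ∘ H)).
    by rewrite SE PE !(functionalE ll) lU lN; ring.
  by rewrite eval_S // -eval_Hsp // -eval_Hsm //; ring.
have evT l (ll : functional l) (lU : l U = 0) (lN : l N = 0) :
    (1 + tau^-1) * (l (sp ∘ sp) - l (mid 2) - a * l sp)
    - (1 + tau) * (l (mid 2) - l (sm ∘ sm) - a * l sm)
    = a * (c * phi) * l (mid 2) + (a + c * t) * (c * l H).
  have := congr1 (fun k => c * k) (eval_turn ll lN); rewrite /= -eval_Hsp // -eval_Hsm //.
  rewrite eval_S // => E; apply/esym/eqP; rewrite -subr_eq0; move/eqP: E; rewrite -subr_eq0.
  by move=> /eqP <-; apply/eqP; ring.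
have evA l (ll : functional l) (lU : l U = 0) (lN : l N = 0) :
    c * l (sp ∘ sp) = c * (z0 * l (mid 2) + z4 * (l sp + l sm)) + z2 * (c * l H).
  by rewrite AE PE !(functionalE ll) lU lN; ring.
have evB l (ll : functional l) (lU : l U = 0) (lN : l N = 0) :
    c * l sp = c * (z0 * l sm + z4 * (l (mid 2) + l (sm ∘ sm)))
      + z2 * (l (mid 2) - l (sm ∘ sm) - a * l sm).
  by rewrite {1}BE -eval_Hsm // !(functionalE ll) lU lN; ring.
have [l1 [lp [lm [[l1l lpl lml] [l11 l1p l1m l1U l1N] [lp1 lpp lpm lpU lpN]
  [lm1 lmp lmm lmU lmN]]]]] := dual_functionals.
have A1 := evA _ l1l l1U l1N; have Ap := evA _ lpl lpU lpN; have Am := evA _ lml lmU lmN.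
have B1 := evB _ l1l l1U l1N; have Bp := evB _ lpl lpU lpN; have Bm := evB _ lml lmU lmN.
have T1 := evT _ l1l l1U l1N; have Tp := evT _ lpl lpU lpN; have Tm := evT _ lml lmU lmN.
have S1 := evS _ l1l l1U l1N; have Sp := evS _ lpl lpU lpN; have Sm := evS _ lml lmU lmN.
have h1 := eval_H l1l l1U l1N; have hp := eval_H lpl lpU lpN; have hm := eval_H lml lmU lmN.
rewrite !(h1, hp, hm) in A1 Ap Am T1 Tp Tm S1 Sp Sm.
rewrite !(l11, l1p, l1m, lp1, lpp, lpm, lm1, lmp, lmm)
  in A1 Ap Am B1 Bp Bm T1 Tp Tm S1 Sp Sm.
move: (l1 (sp ∘ sp)) (lp (sp ∘ sp)) (lm (sp ∘ sp)) (l1 (sm ∘ sm)) (lp (sm ∘ sm))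
  (lm (sm ∘ sm)) A1 Ap Am B1 Bp Bm T1 Tp Tm S1 Sp Sm
  => u1 up um b1 bp bm A1 Ap Am B1 Bp Bm T1 Tp Tm S1 Sp Sm.
(* The minimal cubic of [sm] is the reciprocal of that of [sp]: this equation gives [um != 0], and
   the coordinates [b1], [bp], [bm] of the square of [sm] follow from [u1], [up], [um]. *)
have bpE : um * bp = 1.
  apply: (mulfI c0); transitivity (c * um * bp); first by ring.
  by rewrite Am mulr1 -[RHS]mulr1 Bp; ring.
have um0 : um != 0 by apply: contra_eq_neq bpE => ->; rewrite mul0r eq_sym oner_eq0.
have {}bpE : bp = um^-1 by rewrite -[LHS](mulKf um0) bpE mulr1.
have b1E : b1 = - up / um.
  apply: (mulfI um0); apply: (mulfI c0); transitivity (c * um * b1); first by ring.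
  transitivity (- (c * up)); last by rewrite [um * _]mulrC (divfK um0) mulrN.
  rewrite Am Ap; apply/eqP; rewrite -subr_eq0; apply/eqP.
  by apply: (etrans (etrans _ (esym B1)) _); ring.
have bmE : bm = - u1 / um.
  apply: (mulfI um0); apply: (mulfI c0); transitivity (c * um * bm); first by ring.
  transitivity (- (c * u1)); last by rewrite [um * _]mulrC (divfK um0) mulrN.
  rewrite Am A1; apply/eqP; rewrite -subr_eq0; apply/eqP.
  by apply: (etrans (etrans _ (esym Bm)) _); ring.
exists up, (- u1), um; split=> //.
rewrite {}bpE {}b1E {}bmE in T1 Tp Tm S1 Sp Sm.
split.
- by apply: (etrans (etrans _ Tp) _); ring.
- by apply: (etrans (etrans _ Tm) _); ring.
- by apply: (etrans (etrans _ T1) _); ring.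
- split.
  + by apply: (etrans (etrans _ S1) _); ring.
  + by apply: (etrans (etrans _ Sp) _); ring.
  + by apply: (etrans (etrans _ Sm) _); ring.
Qed.

End Skein.

(* If c = 0, the eigenvalues of the skein relation on N and U would force
   tau + 1/tau = 1 - delta. *)
Lemma skein_H_neq0 : tau - tau^-1 != 0 -> beta = tau ^+ 2 ->
  tau * delta + tau ^+ 2 - tau + 1 != 0 ->
  forall a c, sp - sm = a *: (mid 2 - U) + c *: (H - N) -> c != 0.
Proof.
move=> g0 b2 td a c sk; apply: contraNneq td => c0; move: sk; rewrite c0 scale0r addr0 => sk.
have aE : tau - tau^-1 - a = 0.
  have [x [xl _ xb]] := coordinates; have /= [_ _ _ xN _] := xb 3%N isT.
  have := congr1 (fun f => x 3%N (N ∘ f)) sk.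
  rewrite /= compBr compZr compBr N_sp N_sm compf1 N_U subr0 !(functionalE (xl _)) xN => E.
  by apply: (etrans (etrans _ (congr1 (fun k => k - a) E)) _); ring.
have := @skein_U a 0; rewrite scale0r addr0 => /(_ sk); rewrite b2 mul0r addr0 => E.
by apply/eqP/(skein_degenerate tau0 g0 aE E).
Qed.

(** Turns an identity between linear combinations of morphisms into a scalar identity within the
    reach of [ring]. *)
Lemma End2_ext (l r : C 2%N 2%N) : (forall k, functional k -> k l = k r) -> l = r.
Proof.
have [x [xl xE _]] := coordinates => E.
by rewrite [l]xE [r]xE !(E _ (xl _)).
Qed.

(** P is twice sigma_+ minus the skein difference, which spreads over the other four terms. *)
Lemma S_expand a c w x y : sp - sm = a *: (mid 2 - U) + c *: (H - N) ->
  w *: (mid 2 + U) + x *: P + y *: (H + N) =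
  (w - x * a) *: mid 2 + (w + x * a) *: U + (x *+ 2) *: sp
    + (y - x * c) *: H + (y + x * c) *: N.
Proof.
move=> sk; apply: End2_ext => k kl.
have := congr1 k sk; rewrite !(functionalE kl) PE !(functionalE kl) => E.
have -> : k sm = k sp - (a * (k (mid 2) - k U) + c * (k H - k N)) by rewrite -E; ring.
ring.
Qed.

Lemma F4_relations v :
  (forall n, v ^+ n.+1 != 1) -> (forall u, u ^+ 3 = v ^+ 12 -> u = v ^+ 4) ->
  v != 0 -> tau = v ^+ 6 -> beta = tau ^+ 2 ->
  delta = (v ^+ 4 + 1) * (v ^+ 9 + 1) * (v ^+ 13 - 1) / (v ^+ 11 * (v - 1) * (v ^+ 3 + 1)) ->
  phi = (v ^+ 7 - 1) * (v ^+ 4 - v ^+ 2 + 1) / (v ^+ 5 * (v - 1)) ->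
  m ∘ H = - ((v ^+ 6 + v ^+ 3 + 1) / v ^+ 3) *: m /\
  H ∘ H =
    ((v ^+ 5 + v ^+ 4 + v ^+ 3 + v ^+ 2 + 1) / (v ^+ 2 * (v ^+ 2 + 1) ^+ 2)) *: mid 2
    + (v * (v ^+ 5 + v ^+ 3 + v ^+ 2 + v + 1) / (v ^+ 2 + 1) ^+ 2) *: U
    + (- ((v ^+ 2 + v + 1) * (v ^+ 4 + v ^+ 2 + 1) / (v * (v ^+ 2 + 1) ^+ 2))) *: sp
    + ((v ^+ 5 + 2 * v ^+ 3 + v + 1) / (v ^+ 4 + v ^+ 2)) *: H
    + ((v ^+ 5 + v ^+ 4 + 2 * v ^+ 2 + 1) / (v ^+ 3 + v)) *: N.
Proof.
move=> vX cube_root v0 tE bE dE pE.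
have [a [c sk]] := skein.
have c0 : c != 0.
  apply: (skein_H_neq0 _ bE _ sk); last by rewrite tE dE; apply: twist_loop_neq0.
  by rewrite tE; apply: sub_inv_neq0.
have [w [x [y SE]]] := S_coordinates.
have [f1 [f2 [f3 [f30 sys]]]] := scalar_system sk c0 SE.
have := @eigen_system_of_skein _ _ _ _ _ _ _ _ _ _ _ _ _ (triangle_value a c) bE tau0 f30 c0
  (skein_U sk) erefl sys (S_closure sk c0 SE).
move=> es; rewrite (m_H sk c0).
move: es (mulf_neq0 tau0 (invr_neq0 f30)); move: (triangle_value a c) => t.
rewrite dE pE tE => es s0.
have tv := t_value two0 v0 vX cube_root s0 c0 es.
have [v1 v2 v3 v4 v5] := square_values two0 v0 vX cube_root s0 c0 es.
by split; [rewrite tv|rewrite SE (S_expand _ _ _ sk) v1 v2 v3 v4 v5].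
Qed.

End Algebra.

(** * Transfer to the quotient of T *)

Section Presentation.

Lemma T_of_comp a b c (g : Tterm b c) (f : Tterm a b) :
  T_of (Tcomp g f) = T_of g ∘ T_of f.
Proof. by symmetry; apply: (qpi_comp T_rel_congr). Qed.
Lemma T_of_tens a b c d (f : Tterm a b) (g : Tterm c d) :
  T_of (Ttens f g) = T_of f ⊗ T_of g.
Proof. by symmetry; apply: (qpi_tens T_rel_congr). Qed.
Lemma T_of_scale a b k (f : Tterm a b) : T_of (Tscale k f) = k *: T_of f.
Proof. by symmetry; apply: (qpi_scale T_rel_congr). Qed.
Lemma T_of_eq a b (f g : Tterm a b) : T_rel f g -> T_of f = T_of g.
Proof. by move=> fg; apply/qpiP. Qed.

Variable I : tensor_ideal T.
Local Notation "[ f ]" := (quot_im I f).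

Lemma quot_im_comp a b c (g : T b c) (f : T a b) : [g ∘ f] = [g] ∘ [f].
Proof. by symmetry; apply: (qpi_comp (ideal_rel_congr I)). Qed.
Lemma quot_im_tens a b c d (f : T a b) (g : T c d) : [f ⊗ g] = [f] ⊗ [g].
Proof. by symmetry; apply: (qpi_tens (ideal_rel_congr I)). Qed.
Lemma quot_im_scale a b k (f : T a b) : [k *: f] = k *: [f].
Proof. by symmetry; apply: (qpi_scale (ideal_rel_congr I)). Qed.

Definition im a b (t : Tterm a b) : quot_cat I a b := [T_of t].

Lemma im_comp a b c (g : Tterm b c) (f : Tterm a b) : im (Tcomp g f) = im g ∘ im f.
Proof. by rewrite /im T_of_comp quot_im_comp. Qed.
Lemma im_tens a b c d (f : Tterm a b) (g : Tterm c d) : im (Ttens f g) = im f ⊗ im g.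
Proof. by rewrite /im T_of_tens quot_im_tens. Qed.
Lemma im_scale a b k (f : Tterm a b) : im (Tscale k f) = k *: im f.
Proof. by rewrite /im T_of_scale quot_im_scale. Qed.
Lemma im_eq a b (f g : Tterm a b) : T_rel f g -> im f = im g.
Proof. by move=> fg; rewrite /im (T_of_eq fg). Qed.

End Presentation.

Theorem proposition4p2 (I : tensor_ideal T)
    (hdelta1 : delta <> q ^+ 4 + q ^- 4)
    (hdelta2 : delta <> - q ^+ 16 - q ^- 16)
    (hbasis : @is_basis (mor (quot_cat I) 2 2) 5
       [tuple quot_im I (mid 2); quot_im I U; quot_im I H; quot_im I N;
              quot_im I sigp + quot_im I sigm]) :
  quot_im I m ∘ quot_im I H = (- (qint 9 / qint 3)) *: quot_im I m
  /\
  quot_im I Sq =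
      ((q ^+ 10 + q ^+ 8 + q ^+ 6 + q ^+ 4 + 1)
         / (q ^+ 4 * (q ^+ 4 + 1) ^+ 2)) *: quot_im I (mid 2)
    + ((q ^+ 2 * (q ^+ 10 + q ^+ 6 + q ^+ 4 + q ^+ 2 + 1))
         / (q ^+ 4 + 1) ^+ 2) *: quot_im I U
    - ((qint 2 * qint 3 * qint 6) / qint 4 ^+ 2) *: quot_im I sigp
    + ((q ^+ 10 + 2 * q ^+ 6 + q ^+ 2 + 1) / (q ^+ 8 + q ^+ 4)) *: quot_im I H
    + ((q ^+ 10 + q ^+ 8 + 2 * q ^+ 4 + 1) / (q ^+ 6 + q ^+ 2)) *: quot_im I N.
Proof.
have R := T_rel_relations.
pose i1 := im I (Tid 1); pose cp := im I Tcap; pose cu := im I Tcup; pose mm := im I Tm.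
pose xp := im I Tsigp; pose xm := im I Tsigm.
pose ss : quot_cat I 1%N 2%N := (i1 ⊗ mm) ∘ (cu ⊗ i1).
(* The relations abbreviate s by a term; its image has to be recognised as [ss] before (R2), (R7)
   and the bubble relation apply. *)
have ssE : ss = im I (Tcomp (Ttens (Tid 1) Tm) (Ttens Tcup (Tid 1))).
  by rewrite im_comp (im_tens I (Tid 1) Tm) (im_tens I Tcup (Tid 1)).
have zigl : (cp ⊗ i1) ∘ (i1 ⊗ cu) = i1.
  by rewrite -!im_tens -im_comp; exact: im_eq (R1l R).
have zigr : (i1 ⊗ cp) ∘ (cu ⊗ i1) = i1.
  by rewrite -!im_tens -im_comp; exact: im_eq (R1r R).
have sE : ss = (mm ⊗ i1) ∘ (i1 ⊗ cu).
  by rewrite ssE -!im_tens -im_comp; exact: im_eq (R2 R).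
have slm : (i1 ⊗ cp) ∘ (xm ⊗ i1) = (cp ⊗ i1) ∘ (i1 ⊗ xp).
  by rewrite -!im_tens -!im_comp; exact: im_eq (R3l R).
have slp : (i1 ⊗ cp) ∘ (xp ⊗ i1) = (cp ⊗ i1) ∘ (i1 ⊗ xm).
  by rewrite -!im_tens -!im_comp; exact: im_eq (R3r R).
have smsp : xm ∘ xp = mid 2.
  by rewrite -im_comp -[mid 2]/(im I (Tid 2)); exact: im_eq (R4l R).
have spsm : xp ∘ xm = mid 2.
  by rewrite -im_comp -[mid 2]/(im I (Tid 2)); exact: im_eq (R4r R).
have push : (i1 ⊗ xp) ∘ (xp ⊗ i1) ∘ (i1 ⊗ ss) = (ss ⊗ i1) ∘ xp.
  rewrite ssE -!im_tens -(im_comp I (Ttens (Tid 1) Tsigp) (Ttens Tsigp (Tid 1))) -!im_comp.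
  exact: im_eq (R7 R).
have cap_sp : cp ∘ xp = beta *: cp by rewrite -im_comp -im_scale; exact: im_eq (R8_twist R).
have m_sp : mm ∘ xp = tau *: mm by rewrite -im_comp -im_scale; exact: im_eq (R8_vertex R).
have m_s : mm ∘ ss = phi *: i1 by rewrite ssE -im_comp -im_scale; exact: im_eq (R8_bubble R).
have loop : cp ∘ cu = delta *: mid 0.
  by rewrite -im_comp -[mid 0]/(im I (Tid 0)) -im_scale; exact: im_eq (R8_loop R).
have lolli : mm ∘ cu = 0 by rewrite -im_comp; exact: im_eq (R8_lollipop R).
pose v := q ^+ 2.
have v0 : v != 0 by apply: expf_neq0; apply: q_neq0.
have vX n : v ^+ n.+1 != 1 by rewrite /v -exprM mul2n doubleS qX_neq1.
(* Here [v ^+ 12] is [tau ^+ 2], with [v ^+ 4], that is q^8, as its only cube root in Q(q). *)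
have cube_root (u : Qq) : u ^+ 3 = v ^+ 12 -> u = v ^+ 4.
  by rewrite -[12%N]/(4 * 3)%N exprM; apply: cube_inj sqr_neq_opp3 (expf_neq0 4 v0).
have tE : tau = v ^+ 6 by rewrite /v -exprM.
have bE : beta = tau ^+ 2 by rewrite /beta /tau -exprM.
have tau0 : tau != 0 by rewrite tE expf_neq0.
have beta0 : beta != 0 by rewrite bE expf_neq0.
have sI : quot_im I s = ss.
  by rewrite /s quot_im_comp (quot_im_tens I (mid 1) m) (quot_im_tens I cup (mid 1)).
have UE : quot_im I U = cu ∘ cp by rewrite /U quot_im_comp.
have HE : quot_im I H = (mm ⊗ i1) ∘ (i1 ⊗ ss).
  by rewrite /H quot_im_comp (quot_im_tens I m (mid 1)) (quot_im_tens I (mid 1) s) sI.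
have NE : quot_im I N = ss ∘ mm by rewrite /N quot_im_comp sI.
have [mH SE] := F4_relations zigl zigr (erefl _) sE slm slp smsp spsm push cap_sp m_sp m_s
  loop lolli Qq_two_neq0 tau0 beta0 UE HE NE (erefl _) hbasis
  vX cube_root v0 tE bE (delta_v q_neq0 qX_neq1) (phi_v q_neq0 qX_neq1).
have vq k : v ^+ k = q ^+ (2 * k) by rewrite /v exprM.
have [v2 v3 v4 v5] :
    [/\ v ^+ 2 = q ^+ 4, v ^+ 3 = q ^+ 6, v ^+ 4 = q ^+ 8 & v ^+ 5 = q ^+ 10].
  by split; apply: vq.
split.
  by rewrite [in RHS](qnum_triangle q_neq0 qX_neq1 : qint 9 / qint 3 = _).
rewrite /Sq (quot_im_comp I H H) SE v2 v3 v4 v5.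
rewrite (qnum_crossing_coef q_neq0 qX_neq1
  : (qint 2 * qint 3 * qint 6) / qint 4 ^+ 2 = _) -/v v2 v4.
by rewrite -[in RHS]scaleNr.
Qed.
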